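(* Let $K$ be a totally real number field, $\mathcal O^+$ the set of totally positive algebraic integers of $K$, and $\mathcal P\subset\mathcal O^+$ the set of primitive elements. As formal power $q$-sums with exponents in $\mathcal O^+\cup\{0\}$, \begin{align*} \prod_{\gamma\in\mathcal P}\left(\sum_{n=0}^{\infty}\frac{q^{n^2\gamma}}{(q^{\gamma})_n}\right)&=\prod_{\gamma\in\mathcal P}\left(\prod_{n=0}^{\infty}\frac1{(1-q^{(5n+1)\gamma})(1-q^{(5n+4)\gamma})}\right)=\prod_{\delta\in\mathcal O^+,\ s(\delta)\equiv1,4\ (\mathrm{mod}\ 5)}\frac1{1-q^{\delta}} \end{align*} and \begin{align*} \prod_{\gamma\in\mathcal P}\left(\sum_{n=0}^{\infty}\frac{q^{n(n+1)\gamma}}{(q^{\gamma})_n}\right)&=\prod_{\gamma\in\mathcal P}\left(\prod_{n=0}^{\infty}\frac1{(1-q^{(5n+2)\gamma})(1-q^{(5n+3)\gamma})}\right)=\prod_{\delta\in\mathcal O^+,\ s(\delta)\equiv2,3\ (\mathrm{mod}\ 5)}\frac1{1-q^{\delta}}. \end{align*}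
   Context: An element $\gamma\in\mathcal O^+$ is primitive if $\gamma\notin n\mathcal O^+$ for every rational integer $n\ge 2$. Every $\delta\in\mathcal O^+$ can be written uniquely as $\delta=s(\delta)t(\delta)$ with $s(\delta)\in\mathbb Z^+$ (the scale) and $t(\delta)\in\mathcal P$ (the primitive factor). Formal power $q$-sums: with $H=\mathcal O^+\cup\{0\}$ (a monoid under addition), $\mathbb R[[q]]_H$ is the ring of formal expressions $\sum_{\delta\in H}c_\delta q^\delta$, $c_\delta\in\mathbb R$, with coefficientwise addition and product $(\sum c_\delta q^\delta)(\sum d_\delta q^\delta)=\sum_{\gamma}\left(\sum_{\alpha+\beta=\gamma}c_\alpha d_\beta\right)q^\gamma$; this is well defined because each $\gamma\in H$ has finitely many decompositions $\gamma=\alpha+\beta$ with $\alpha,\beta\in H$. Infinite sums are taken coefficientwise. For $\delta\in\mathcal O^+$, $\frac1{1-q^\delta}$ means $1+q^\delta+q^{2\delta}+\cdots$. For a family $f_j=\sum_\delta a_{j,\delta}q^\delta$ ($j\in J$) with all $a_{j,0}=1$ and, for each nonzero $\delta\in H$, only finitely many $j$ with $a_{j,\delta}\ne0$, the product $\prod_{j\in J}f_j$ is $\sum_\delta c_\delta q^\delta$, where $c_\delta$ is the sum of $a_{j_1,\delta_1}\cdots a_{j_r,\delta_r}$ over all finite sets of pairs $\{(j_1,\delta_1),\ldots,(j_r,\delta_r)\}$ with $j_1,\dots,j_r\in J$ pairwise distinct, $\delta_1,\ldots,\delta_r\in\mathcal O^+$ and $\delta_1+\cdots+\delta_r=\delta$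 (so $c_0=1$). For $\gamma\in\mathcal O^+$, $(q^\gamma)_n=\prod_{j=1}^n(1-q^{j\gamma})$, with $(q^\gamma)_0=1$. *)

(* Defs.v *)
From HB Require Import structures.
From mathcomp Require Import all_boot all_order all_algebra all_field.
From mathcomp Require Import finmap complex.
From mathcomp Require Import boolp classical_sets functions fsbigop reals.
Set Implicit Arguments.
Unset Strict Implicit.
Unset Printing Implicit Defensive.
Import Order.TTheory GRing.Theory Num.Theory.
Local Open Scope classical_set_scope.
Local Open Scope ring_scope.

(* A number field is a finite extension of the rationals, [K : fieldExtType rat].
   It is totally real when every complex embedding has real values. *)
Definition totally_real (R : realType) (K : fieldExtType rat) : Prop :=
  forall (sigma : {rmorphism K -> R[i]}) (x : K), sigma x \is Num.real.

Definition algebraic_integer (K : fieldExtType rat) (x : K) : Prop :=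
  integralOver (intr : int -> K) x.

Definition totally_positive (R : realType) (K : fieldExtType rat) (x : K) :
  Prop := forall sigma : {rmorphism K -> R}, 0 < sigma x.

Definition Oplus (R : realType) (K : fieldExtType rat) : set K :=
  [set x | algebraic_integer x /\ totally_positive R x].
Arguments Oplus : clear implicits.

(* The monoid H of exponents: the totally positive integers, together with 0. *)
Definition in_expo (R : realType) (K : fieldExtType rat) : {pred K} :=
  fun x => `[< x = 0 \/ Oplus R K x >].
Arguments in_expo : clear implicits.

Lemma in_expo_closed (R : realType) (K : fieldExtType rat) :
  GRing.nmod_closed (in_expo R K).
Proof.
split=> [|x y]; first by apply/asboolP; left.
move=> /asboolP[->|[ix px]]; first by rewrite add0r.
move=> /asboolP[->|[iy py]]; first by rewrite addr0; apply/asboolP; right.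
apply/asboolP; right; split; first exact: integral_add.
by move=> sigma; rewrite rmorphD addr_gt0.
Qed.

HB.instance Definition _ (R : realType) (K : fieldExtType rat) :=
  GRing.isAddClosed.Build K (in_expo R K) (in_expo_closed R K).

Record expo (R : realType) (K : fieldExtType rat) :=
  Expo { expo_val :> K; expo_valP : expo_val \in in_expo R K }.

HB.instance Definition _ (R : realType) (K : fieldExtType rat) :=
  [isSub for @expo_val R K].
HB.instance Definition _ (R : realType) (K : fieldExtType rat) :=
  [Choice of expo R K by <:].
HB.instance Definition _ (R : realType) (K : fieldExtType rat) :=
  GRing.SubChoice_isSubNmodule.Build K _ (expo R K) (in_expo_closed R K).

Section Qsums.
Variables (R : realType) (K : fieldExtType rat).
Local Notation H := (expo R K).
Implicit Types (d : H).

Definition pos_expo : set H := [set d | Oplus R K (expo_val d)].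

Definition primitive : set H :=
  [set d | pos_expo d /\
     forall n : nat, (2 <= n)%N -> ~ exists2 e, pos_expo e & d = e *+ n].

(* The positive integer s such that d = s t with t primitive. *)
Definition scale d : nat :=
  xget 0%N [set s | (0 < s)%N /\ exists2 t, primitive t & d = t *+ s].

(* The formal sum of the c_d q^d, given by its coefficients d |-> c_d. *)
Definition qsum : Type := H -> R.

HB.instance Definition _ := GRing.Zmodule.copy qsum (H -> R).
HB.instance Definition _ := Choice.on qsum.

(* The monomial q^d. *)
Definition qX d : qsum := fun e => (e == d)%:R.

Definition qone : qsum := qX 0.

(* The sums [\sum_(i \in A)] below are over possibly infinite sets A, of terms
   of which only finitely many are nonzero (their value is 0 otherwise). *)
Definition qmul (f g : qsum) : qsum := fun c =>
  \sum_(p \in [set p : H * H | p.1 + p.2 = c]) f p.1 * g p.2.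

(* The multiplicative inverse, which is unique when it exists. *)
Definition qinv (f : qsum) : qsum := xget 0 [set g | qmul f g = qone].

Definition qdiv (f g : qsum) : qsum := qmul f (qinv g).

(* The sum of f_0, f_1, ..., coefficientwise. *)
Definition qseries (f : nat -> qsum) : qsum := fun d =>
  \sum_(n \in [set: nat]) f n d.

(* 1 / (1 - q^d), that is 1 + q^d + q^(2d) + ... *)
Definition qgeom d : qsum := qseries (fun k => qX (d *+ k)).

(* The product of the f_j for j in A, where each f_j has constant coefficient 1
   and, for each d <> 0, only finitely many f_j have a nonzero coefficient at d.
   A term of the coefficient at d is indexed by a finite set S of pairs
   (j, e), with distinct first components in A. *)
Definition qprod (J : choiceType) (A : set J) (f : J -> qsum) : qsum := fun d =>
  \sum_(S \in [set S : {fset J * H} |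
                 [/\ forall p, p \in S -> A p.1 /\ pos_expo p.2,
                     {in S &, injective fst} &
                     \sum_(p <- S) p.2 = d]])
     \prod_(p <- S) f p.1 p.2.

(* (q^c)_n *)
Definition qpoch (c : H) (n : nat) : qsum :=
  \big[qmul/qone]_(1 <= j < n.+1) (qone - qX (c *+ j)).

End Qsums.

Arguments primitive {R K}.
Arguments qone {R K}.

(* Main.v *)
(** Let [G_k] be the sum of the [q^(n^2 + k n) / (q)_n]. Then [G_k = G_(k+1) + q^(k+1) G_(k+2)] and
    [G_k] tends to [1]; these two properties determine the sequence, and they are shared by
    [(q)_infinity^-1] times an explicit alternating series. For [k = 0] and [k = 1] the Jacobi
    triple product evaluates that series, which gives the Rogers-Ramanujan identities.

    All this is done in a commutative ring where [q] is nilpotent. Such rings come from series in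
    several exponents: since [K] is totally real, a totally positive integer [d] dominates finitely
    many others (their conjugates are bounded by those of [d], so their minimal polynomials come
    from a finite list), and the series truncated at the exponents below [d] form a ring in which
    every [q^c], [c <> 0], is nilpotent and every infinite product is finite.

    The second equalities regroup the product along [d = s(d) t(d)]. *)

From HB Require Import structures.
Require Import Defs.
From mathcomp Require Import all_boot all_order all_algebra all_field.
From mathcomp Require Import finmap complex spectral.
From mathcomp Require Import boolp classical_sets functions fsbigop reals cardinality.
From mathcomp Require Import ring zify.
Set Implicit Arguments.
Unset Strict Implicit.
Unset Printing Implicit Defensive.
Import Order.TTheory GRing.Theory Num.Theory.
Local Open Scope classical_set_scope.
Local Open Scope ring_scope.

(** * The Rogers-Ramanujan identities with a nilpotent q *)

Section RogersRamanujan.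
Variable A : comNzRingType.
Implicit Types (q z w : A) (N M n k : nat).

(* Throughout, [N] is such that [q ^+ N = 0], so that sums over [n < N] are complete. *)
Definition geom N q : A := \sum_(i < N) q ^+ i.

Lemma geomP N q : q ^+ N = 0 -> (1 - q) * geom N q = 1.
Proof.
move=> qN; have := subrX1 q N; rewrite qN -/(geom N q) => h.
by rewrite -opprB mulNr -h sub0r opprK.
Qed.

Lemma geom0 N : (0 < N)%N -> geom N 0 = 1.
Proof.
case: N => // N _; rewrite /geom big_ord_recl expr0 big1 ?addr0 // => i _.
by rewrite expr0n.
Qed.

Lemma exp_nilp N q n : q ^+ N = 0 -> (N <= n)%N -> q ^+ n = 0.
Proof. by move=> qN /subnK <-; rewrite exprD qN mulr0. Qed.

Definition poch q n : A := \prod_(i < n) (1 - q ^+ i.+1).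
Definition ipoch N q n : A := \prod_(i < n) geom N (q ^+ i.+1).

Lemma pochS q n : poch q n.+1 = poch q n * (1 - q ^+ n.+1).
Proof. by rewrite /poch big_ord_recr. Qed.

Lemma ipoch0 N q : ipoch N q 0 = 1.
Proof. exact: big_ord0. Qed.

Lemma pochK N q n : q ^+ N = 0 -> poch q n * ipoch N q n = 1.
Proof.
move=> qN; rewrite -big_split big1 //= => i _.
by rewrite geomP // -exprM mulnC exprM qN expr0n.
Qed.

Lemma ipochS N q n : q ^+ N = 0 ->
  ipoch N q n = ipoch N q n.+1 * (1 - q ^+ n.+1).
Proof.
move=> qN; rewrite {2}/ipoch big_ord_recr /= -/(ipoch N q n) -mulrA.
by rewrite [_ * (1 - _)]mulrC geomP ?mulr1 // -exprM mulnC exprM qN expr0n.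
Qed.

Lemma poch_stable N q n : q ^+ N = 0 -> (N <= n)%N -> poch q n = poch q N.
Proof.
move=> qN; elim: n => [|n IH]; first by rewrite leqn0 => /eqP ->.
rewrite leq_eqVlt => /predU1P[-> //|Nn].
by rewrite pochS IH // (exp_nilp qN) ?subr0 ?mulr1 //; lia.
Qed.

Lemma ipoch_stable N q n : q ^+ N = 0 -> (N <= n)%N -> ipoch N q n = ipoch N q N.
Proof.
move=> qN Nn; rewrite -[LHS]mul1r -(pochK N qN) -(poch_stable qN Nn).
by rewrite mulrAC pochK // mul1r.
Qed.

(** The two sums differ by [F 0 - F N], so the range stays [N] after the shift. *)
Lemma sum_shift (F : nat -> A) N : F 0 = 0 -> F N = 0 ->
  \sum_(n < N) F n = \sum_(n < N) F n.+1.
Proof.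
move=> F0 FN; apply/eqP; rewrite eq_sym -subr_eq0 -sumrB.
have := @telescope_sumr A 0 N F (leq0n N).
by rewrite big_mkord => ->; rewrite F0 FN subr0.
Qed.

(** * The recurrence and its two solutions *)

Definition rr_rec q (G : nat -> A) :=
  forall k, G k = G k.+1 + q ^+ k.+1 * G k.+2.

(** The recurrence expresses each term by later ones, so agreement for large [k] propagates
    downwards. *)
Lemma rr_rec_inj q (F G : nat -> A) K : rr_rec q F -> rr_rec q G ->
  (forall k, (K <= k)%N -> F k = G k) -> F =1 G.
Proof.
move=> hF hG FG k.
have: forall i j, (K <= j + i)%N -> F j = G j; last by move/(_ K k); apply; lia.
elim=> [|i IH] j hj; first by apply: FG; lia.
by rewrite hF hG !IH //; lia.
Qed.

Definition rr_sum N q k : A := \sum_(n < N) q ^+ (n ^ 2 + k * n) * ipoch N q n.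

(** In [G_k - G_(k+1)] the [n]-th term carries the factor [1 - q^n], which kills [n = 0] and
    otherwise cancels the last factor of [(q)_n]. After the shift of [n] by one the exponent is
    [(k + 1) + n^2 + (k + 2) n]. *)
Lemma rr_sum_rec N q : q ^+ N = 0 -> rr_rec q (rr_sum N q).
Proof.
move=> qN k; apply/eqP; rewrite addrC -subr_eq; apply/eqP.
rewrite /rr_sum -sumrB mulr_sumr.
pose c n := q ^+ (n ^ 2 + k * n) * ipoch N q n * (1 - q ^+ n).
rewrite (eq_bigr (fun n : 'I_N => c n)); last first.
  move=> n _; rewrite /c.
  have -> : (n ^ 2 + k.+1 * n = n ^ 2 + k * n + n)%N by lia.
  by rewrite [in X in _ - X * _]exprD; ring.
rewrite (sum_shift (F := c)) /c.
- apply: eq_bigr => n _; rewrite -mulrA -ipochS // mulrA -exprD.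
  by congr (_ ^+ _ * _); lia.
- by rewrite expr0 subrr mulr0.
- by rewrite (exp_nilp qN) ?mul0r //; nia.
Qed.

(* [5 * 'C(n, 2) + 3 * n = n (5 n + 1) / 2] *)
Definition rr_expo n : nat := 5 * 'C(n, 2) + 3 * n.

Lemma rr_expoS n : rr_expo n.+1 = (rr_expo n + (5 * n + 3))%N.
Proof. by rewrite /rr_expo binS bin1; lia. Qed.

(* Divided by [poch q N], [rr_alt N q k] and [rr_alt1 N q k] are the series
   [J_2(q^k)] and [J_1(q^k)] of the Rogers-Selberg proof. *)
Definition rr_alt N q k : A := \sum_(n < N) (-1) ^+ n * q ^+ (2 * k * n + rr_expo n)
  * (1 - q ^+ (2 * k + 2 + 4 * n)) * ipoch N q n * poch q (k + n).

Definition rr_alt1 N q k : A := \sum_(n < N) (-1) ^+ n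
  * q ^+ (2 * k * n + n + rr_expo n)
  * (1 - q ^+ (k + 1 + 2 * n)) * ipoch N q n * poch q (k + n).

(** Split [1 - q^(k+1+2n)] as [(1 - q^n) + q^n (1 - q^(k+n+1))]. The first part cancels against
    [ipoch], is shifted by one, and joins the second part to form the terms of [rr_alt] at
    [k + 1]. *)
Lemma rr_alt1E N q k : q ^+ N = 0 -> rr_alt1 N q k = rr_alt N q k.+1.
Proof.
move=> qN.
pose a n := (-1) ^+ n * q ^+ (2 * k * n + n + rr_expo n) *
  (1 - q ^+ n) * ipoch N q n * poch q (k + n).
pose b n := (-1) ^+ n * q ^+ (2 * k.+1 * n + rr_expo n) *
  ipoch N q n * poch q (k.+1 + n).
transitivity (\sum_(n < N) (a n + b n)).
  apply: eq_bigr => n _; rewrite /a /b addSn pochS.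
  have -> : (2 * k.+1 * n + rr_expo n = 2 * k * n + n + rr_expo n + n)%N by lia.
  have -> : (k + 1 + 2 * n = n + (k + n).+1)%N by lia.
  by rewrite !exprD; ring.
rewrite big_split /= (sum_shift (F := a)); last 2 first.
- by rewrite /a expr0 subrr !mulr0 !mul0r.
- by rewrite /a (exp_nilp (n := _ + rr_expo N) qN) ?(mulr0, mul0r) //; rewrite /rr_expo; lia.
rewrite -big_split; apply: eq_bigr => n _ /=; rewrite /a /b.
rewrite [(k + _.+1)%N]addnS -addSn -[_ * (1 - _) * ipoch _ _ _]mulrA.
rewrite [(1 - _) * ipoch _ _ _]mulrC -ipochS // rr_expoS.
have -> : (2 * k * n.+1 + n.+1 + (rr_expo n + (5 * n + 3)) =
   2 * k.+1 * n + rr_expo n + (2 * k.+1 + 2 + 4 * n))%N by lia.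
rewrite [(-1) ^+ n.+1]exprS [q ^+ (_ + (2 * _ + _ + _))]exprD.
by ring.
Qed.

(** By [rr_alt1E] the claim is that [rr_alt - rr_alt1] at [k] equals [q^(k+1)] times [rr_alt1] at
    [k + 1]. The split and shift are as before, now with [(1 - q^(2k+2+4n)) - q^n (1 - q^(k+1+2n)) =
    (1 - q^n) + q^(3n+k+1) (1 - q^(k+n+1))]. *)
Lemma rr_alt_rec N q : q ^+ N = 0 -> rr_rec q (rr_alt N q).
Proof.
move=> qN k; rewrite -!rr_alt1E //.
apply/eqP; rewrite addrC -subr_eq; apply/eqP; rewrite /rr_alt {1}/rr_alt1 -sumrB.
pose a n := (-1) ^+ n * q ^+ (2 * k * n + rr_expo n) *
  (1 - q ^+ n) * ipoch N q n * poch q (k + n).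
pose b n := (-1) ^+ n * q ^+ (2 * k * n + rr_expo n + 3 * n + k.+1) *
  ipoch N q n * poch q (k.+1 + n).
transitivity (\sum_(n < N) (a n + b n)).
  apply: eq_bigr => n _; rewrite /a /b addSn pochS.
  have -> : (2 * k * n + n + rr_expo n = 2 * k * n + rr_expo n + n)%N by lia.
  have -> : (2 * k + 2 + 4 * n = k + 1 + n + (k + 1 + n) + (n + n))%N by lia.
  have -> : ((k + n).+1 = k + 1 + n)%N by lia.
  have -> : (k + 1 + 2 * n = k + 1 + n + n)%N by lia.
  have -> : (2 * k * n + rr_expo n + 3 * n + k.+1 =
             2 * k * n + rr_expo n + (k + 1 + n) + n + n)%N by lia.
  by rewrite !exprD; ring.
rewrite big_split /= (sum_shift (F := a)); last 2 first.
- by rewrite /a expr0 subrr !mulr0 !mul0r.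
- by rewrite /a (exp_nilp (n := _ + rr_expo N) qN) ?(mulr0, mul0r) //; rewrite /rr_expo; lia.
rewrite -big_split mulr_sumr; apply: eq_bigr => n _ /=; rewrite /a /b.
rewrite [(k + _.+1)%N]addnS -addSn -[_ * (1 - _) * ipoch _ _ _]mulrA.
rewrite [(1 - _) * ipoch _ _ _]mulrC -ipochS // rr_expoS.
have -> : (2 * k * n.+1 + (rr_expo n + (5 * n + 3)) =
   k.+1 + (2 * k.+1 * n + n + rr_expo n) + (k.+1 + 1 + 2 * n))%N by lia.
have -> : (2 * k * n + rr_expo n + 3 * n + k.+1 =
   k.+1 + (2 * k.+1 * n + n + rr_expo n))%N by lia.
rewrite [(-1) ^+ n.+1]exprS [q ^+ (_ + (_ + 2 * n))]exprD.
rewrite [q ^+ (k.+1 + _)]exprD.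
by ring.
Qed.

(** Both sides satisfy [rr_rec] and equal [1] once [k >= N], where only the terms [n = 0]
    survive. *)
Lemma rr_sum_alt N q k : q ^+ N = 0 ->
  rr_sum N q k = ipoch N q N * rr_alt N q k.
Proof.
move=> qN; case: N qN => [|N] qN.
  (* For [N = 0] the hypothesis says [1 = 0]. *)
  by have := oner_eq0 A; rewrite -[1](expr0 q) qN eqxx.
apply: (@rr_rec_inj q _ (fun k => ipoch N.+1 q N.+1 * rr_alt N.+1 q k) N.+1).
- exact: rr_sum_rec.
- by move=> j; rewrite rr_alt_rec // mulrDr mulrCA.
move=> j Nj; rewrite /rr_sum /rr_alt !big_ord_recl !big1 /=; last 2 first.
- move=> n _; rewrite (exp_nilp (n := (_ + rr_expo _)) qN) ?(mulr0, mul0r) //.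
  by apply: leq_trans Nj (leq_trans _ (leq_addr _ _)); rewrite mulnAC leq_pmull // muln_gt0.
- move=> n _; rewrite (exp_nilp (n := (_ ^ 2 + _)) qN) ?(mulr0, mul0r) //.
  by apply: leq_trans Nj (leq_trans _ (leq_addl _ _)); rewrite leq_pmulr.
rewrite !muln0 !addn0 !expr0 ipoch0 !mul1r !mulr1 !addr0.
rewrite [X in 1 - X](exp_nilp qN) ?subr0 ?mul1r; last lia.
by rewrite (poch_stable qN Nj) mulrC pochK.
Qed.


(** * Gaussian binomial coefficients, with division written as multiplication by [ipoch] *)

Definition qbin N q n k : A :=
  if (k <= n)%N then poch q n * ipoch N q k * ipoch N q (n - k) else 0.

Lemma qbinn N q n : q ^+ N = 0 -> qbin N q n n = 1.
Proof.
by move=> qN; rewrite /qbin leqnn subnn ipoch0 mulr1 pochK.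
Qed.

Lemma qbin_small N q n k : (n < k)%N -> qbin N q n k = 0.
Proof. by move=> nk; rewrite /qbin leqNgt nk. Qed.

(** A Pascal rule: over the denominator [(q)_(k+1) (q)_(n-k)] it reads [1 - q^(n+1) = (1 - q^(k+1))
    + q^(k+1) (1 - q^(n-k))]. *)
Lemma qbinS N q n k : q ^+ N = 0 ->
  qbin N q n.+1 k.+1 = qbin N q n k + q ^+ k.+1 * qbin N q n k.+1.
Proof.
move=> qN; case: (ltngtP n k) => [nk|kn|->].
- by rewrite !qbin_small ?mulr0 ?addr0 //; lia.
- rewrite /qbin ltnS kn ltnW // subSS pochS [in RHS](ipochS k qN).
  have -> : (n - k = (n - k.+1).+1)%N by lia.
  rewrite [ipoch N q (n - k.+1)](ipochS _ qN).
  have -> : (n.+1 = k.+1 + (n - k.+1).+1)%N by lia.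
  by rewrite (exprD q k.+1); ring.
- by rewrite !qbinn // qbin_small // mulr0 addr0.
Qed.

(** The mirror rule, from [1 - q^(n+1) = q^(n-k) (1 - q^(k+1)) + (1 - q^(n-k))]. *)
Lemma qbinSr N q n k : q ^+ N = 0 ->
  qbin N q n.+1 k.+1 = q ^+ (n - k) * qbin N q n k + qbin N q n k.+1.
Proof.
move=> qN; case: (ltngtP n k) => [nk|kn|->].
- by rewrite !qbin_small ?mulr0 ?addr0 //; lia.
- rewrite /qbin ltnS kn ltnW // subSS pochS [in RHS](ipochS k qN).
  have -> : (n - k = (n - k.+1).+1)%N by lia.
  rewrite [ipoch N q (n - k.+1)](ipochS _ qN).
  have -> : (n.+1 = k.+1 + (n - k.+1).+1)%N by lia.
  by rewrite (exprD q k.+1); ring.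
- by rewrite !qbinn // qbin_small // subnn mulr1 addr0.
Qed.

(** Row [2m] indexed from its middle. The row is symmetric, so natural [j] cover both sides. *)
Definition cbin N q m j := qbin N q (2 * m) (m + j).

(** Two rows at once: [qbinSr], then [qbinS] on both resulting terms. This matches the two factors
    that the triple product gains from [m] to [m + 1]. *)
Lemma cbinS N q m j : q ^+ N = 0 -> cbin N q m.+1 j.+1 =
  q ^+ (m - j) * cbin N q m j + (1 + q ^+ (2 * m + 1)) * cbin N q m j.+1
  + q ^+ (m + j + 2) * cbin N q m j.+2.
Proof.
move=> qN; rewrite /cbin.
have -> : (2 * m.+1 = (2 * m).+2)%N by lia.
have -> : (m.+1 + j.+1 = (m + j).+2)%N by lia.
rewrite qbinSr // !qbinS // !addnS.
case: (leqP j m) => jm; last by rewrite !qbin_small ?(mulr0, addr0) //; lia.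
have -> : ((2 * m).+1 - (m + j).+1 = m - j)%N by lia.
have -> : ((2 * m + 0).+1 = m - j + (m + j).+1)%N by lia.
by rewrite addn0 exprD; ring.
Qed.

Lemma qbin_sym N q n k : (k <= n)%N -> qbin N q n (n - k) = qbin N q n k.
Proof. by move=> kn; rewrite /qbin kn leq_subr subKn // mulrAC. Qed.

(** The neighbours of the middle, at indices [-1] and [1], are equal by symmetry, whence the
    coefficient [2]. *)
Lemma cbin0S N q m : q ^+ N = 0 -> cbin N q m.+1 0 =
  (1 + q ^+ (2 * m + 1)) * cbin N q m 0 + 2 * q ^+ m.+1 * cbin N q m 1.
Proof.
move=> qN; rewrite /cbin !addn0 !addn1.
have -> : (2 * m.+1 = (2 * m).+2)%N by lia.
have sym : qbin N q (2 * m).+1 m = qbin N q (2 * m).+1 m.+1.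
  by rewrite -qbin_sym; [congr qbin|]; lia.
rewrite qbinSr // sym {1}qbinSr // qbinS //.
have -> : ((2 * m).+1 - m = m.+1)%N by lia.
have -> : ((2 * m).+1 = m.+1 + m)%N by lia.
have -> : (2 * m - m = m)%N by lia.
by rewrite exprD; ring.
Qed.

(** * The Jacobi triple product: finite form and limit *)

Section JacobiTripleProduct.
Variables (N : nat) (p : A).
Hypothesis pN : p ^+ N = 0.

(** For [p = z w] this is the usual summand [(-1)^j z^j p^(j(j-1)/2)]. Exchanging [z] and [w] gives
    the summand of index [-j] without inverting [z]. *)
Definition jtp_term z w j : A := (-1) ^+ j * z ^+ 'C(j.+1, 2) * w ^+ 'C(j, 2).

Lemma jtp_termS z w j : p = z * w ->
  jtp_term z w j.+1 = - (z * p ^+ j) * jtp_term z w j.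
Proof.
move=> ->; rewrite /jtp_term (binS j.+1) bin1 (binS j) bin1.
move: 'C(j, 2) => c; rewrite !exprD.
by rewrite [(-1) ^+ j.+1]exprS exprMn exprS; ring.
Qed.

Definition jtp_half M m z w : A :=
  \sum_(j < M) jtp_term z w j.+1 * cbin N p m j.+1.

Lemma cbin_small m j : (m < j)%N -> cbin N p m j = 0.
Proof. by move=> mj; apply: qbin_small; lia. Qed.

(** The factor on the left is [(1 - z p^m) (1 - w p^m)]. By [cbinS] the termwise difference of the
    two halves telescopes in [j]; what remains is the exchange with the middle index. *)
Lemma jtp_halfS M m z w : p = z * w -> (m < M)%N ->
  (1 + p ^+ (2 * m + 1) - p ^+ m * (z + w)) * jtp_half M m z w =
  jtp_half M m.+1 z w + z * p ^+ m * cbin N p m 0 + p ^+ m.+1 * cbin N p m 1.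
Proof.
move=> pE mM; rewrite -[RHS]addrA.
apply/eqP; rewrite [eqbRHS]addrC -subr_eq; apply/eqP.
rewrite mulr_sumr -sumrB.
pose a j := - (jtp_term z w j.+1 * p ^+ (m - j) * cbin N p m j).
pose b j := - (p ^+ m * w * jtp_term z w j.+1 * cbin N p m j.+1).
transitivity (\sum_(j < M) ((a j + b j) - (a j.+1 + b j.+1))).
  apply: eq_bigr => j _; rewrite cbinS // /a /b (jtp_termS j.+1 pE).
  have -> : p ^+ (m + j + 2) = z * w * p ^+ j.+1 * p ^+ m.
    by rewrite -pE -exprS -exprD; congr (_ ^+ _); lia.
  (* For [j >= m] the subtraction in [m - j.+1] is truncated, but that power multiplies a
     coefficient [cbin] that is [0]. *)
  case: (ltnP j m) => jm.
    have -> : p ^+ m = p ^+ j.+1 * p ^+ (m - j.+1) by rewrite -exprD subnKC.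
    by ring.
  by rewrite (@cbin_small m j.+1) //; ring.
have := @telescope_sumr A 0 M (fun j => - (a j + b j)) (leq0n M).
rewrite big_mkord => h.
under eq_bigr => j _ do rewrite addrC -[a j + b j]opprK.
rewrite h /a /b subn0 !(@cbin_small m M) ?(@cbin_small m M.+1) //; last exact: leqW.
rewrite (jtp_termS 0 pE) /jtp_term (@bin_small 1 2) // (@bin_small 0 2) //.
by rewrite !expr0 (exprS p m) [X in _ = _ + X * _ * _]pE; ring.
Qed.

(* The finite form of the triple product, with [z w = p] and the summands of
   index [j] and [-j] paired. *)
Definition jtp M m z w := cbin N p m 0 + jtp_half M m z w + jtp_half M m w z.

(** The boundary terms that [jtp_halfS] yields for the two halves are those that [cbin0S] requires
    of the middle coefficient. *)
Lemma jtp_prod M m z w : p = z * w -> (m < M)%N ->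
  \prod_(i < m) ((1 - z * p ^+ i) * (1 - w * p ^+ i)) = jtp M m z w.
Proof.
move=> pE; have pE' : p = w * z by rewrite mulrC.
elim: m => [|m IH] mM.
  rewrite big_ord0 /jtp /jtp_half !big1 => [|j _|j _].
  - by rewrite /cbin qbinn // !addr0.
  - by rewrite cbin_small ?mulr0.
  - by rewrite cbin_small ?mulr0.
rewrite big_ord_recr IH 1?ltnW //= /jtp.
have -> : (1 - z * p ^+ m) * (1 - w * p ^+ m) =
          1 + p ^+ (2 * m + 1) - p ^+ m * (z + w).
  by rewrite exprD expr1 mulnC exprM {4}pE; ring.
rewrite mulrC 2!mulrDr jtp_halfS // 1?ltnW // [z + w]addrC jtp_halfS // 1?ltnW //.
by rewrite cbin0S // exprD expr1 [p ^+ m.+1]exprS; ring.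
Qed.

(** For [m >= 2N] and [j <= N] the numbers [2m], [m + j] and [m - j] are all at least [N], so
    [cbin N p m j] has reached its limit [1 / (p)_infinity]. Summands of larger index contain a
    vanishing power of [p]. *)
Lemma jtp_limit z w m : p = z * w -> (2 * N <= m)%N ->
  \prod_(i < m) ((1 - z * p ^+ i) * (1 - w * p ^+ i)) =
  ipoch N p N * (1 + \sum_(j < N) (jtp_term z w j.+1 + jtp_term w z j.+1)).
Proof.
move=> pE Nm.
have term0 z' w' j : p = z' * w' -> (N <= j)%N -> jtp_term z' w' j.+1 = 0.
  by move=> pE' Nj; rewrite (jtp_termS _ pE') (exp_nilp pN Nj) mulr0 oppr0 mul0r.
have half z' w' : p = z' * w' -> jtp_half m.+1 m z' w' =
    ipoch N p N * \sum_(j < N) jtp_term z' w' j.+1.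
  move=> pE'; rewrite /jtp_half.
  rewrite -(big_mkord xpredT (fun j => jtp_term z' w' j.+1 * cbin N p m j.+1)).
  rewrite (@big_cat_nat _ _ _ N) //=; last lia.
  rewrite [X in _ + X]big1_seq ?addr0 => [|j]; last first.
    by rewrite mem_index_iota => /andP[_ /andP[Nj _]]; rewrite term0 ?mul0r.
  rewrite big_mkord mulr_sumr; apply: eq_bigr => j _.
  have jN := ltn_ord j; rewrite /cbin /qbin ifT; last lia.
  rewrite (ipoch_stable (n := _ + _) pN); last lia.
  rewrite (ipoch_stable (n := _ - _) pN); last lia.
  by rewrite (poch_stable pN) ?(pochK _ pN) ?mul1r 1?mulrC //; lia.
have pE' : p = w * z by rewrite mulrC.
have cbin0 : cbin N p m 0 = ipoch N p N.
  rewrite /cbin /qbin ifT; last lia.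
  rewrite (ipoch_stable (n := _ + _) pN); last lia.
  rewrite (ipoch_stable (n := _ - _) pN); last lia.
  by rewrite (poch_stable pN) ?(pochK _ pN) ?mul1r //; lia.
by rewrite (@jtp_prod m.+1) // /jtp (half _ _ pE) (half _ _ pE') cbin0 big_split /=
  !mulrDr mulr1 addrA.
Qed.

End JacobiTripleProduct.

(** The triple product for [z = q^a], [w = q^(5-a)]. The summand of index [n] in one half is paired
    with that of index [n + 1] in the other; their exponents differ by [a + 2an]. *)
Lemma theta_prod N q a m : q ^+ N = 0 -> (a < 5)%N -> (2 * N <= m)%N ->
  \sum_(n < N) (-1) ^+ n * q ^+ (5 * 'C(n, 2) + (5 - a) * n) * (1 - q ^+ (a + 2 * a * n)) =
  poch (q ^+ 5) m *
  \prod_(i < m) ((1 - q ^+ (5 * i + a)) * (1 - q ^+ (5 * i + (5 - a)))).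
Proof.
move=> qN a5 Nm; have pN : (q ^+ 5) ^+ N = 0 by rewrite -exprM mulnC exprM qN expr0n.
have pE : q ^+ 5 = q ^+ a * q ^+ (5 - a) by rewrite -exprD subnKC // ltnW.
have := jtp_limit pN pE Nm.
under eq_bigr => i _ do rewrite -!exprM -!exprD ![(_ + 5 * _)%N]addnC.
move=> ->; rewrite (poch_stable pN) ?mulrA ?(pochK _ pN) ?mul1r //; last lia.
pose F n := jtp_term (q ^+ (5 - a)) (q ^+ a) n.
have termE (b c n : nat) : jtp_term (q ^+ b) (q ^+ c) n =
    (-1) ^+ n * q ^+ ((b + c) * 'C(n, 2) + b * n).
  rewrite /jtp_term binS bin1 -!exprM -mulrA -exprD.
  by congr (_ * _ ^+ _); lia.
case: N qN {pN Nm} => [|N] qN.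
  by have := oner_eq0 A; rewrite -[1](expr0 q) qN eqxx.
(* This half loses its last summand, which is [0], and takes the constant [1] as its summand of
   index [0]. *)
rewrite big_split /= [X in 1 + (_ + X)]big_ord_recr /= [X in _ + (_ + (_ + X))]termE.
rewrite [X in _ + (_ + (_ + (_ * X)))](exp_nilp qN) ?mulr0 ?addr0; last first.
  by apply: leq_trans (leq_addl _ _); rewrite leq_pmull // subn_gt0.
have FE : \sum_(j < N.+1) F j = 1 + \sum_(j < N) F j.+1.
  by rewrite big_ord_recl /F /jtp_term !expr0 !mulr1.
rewrite addrCA -FE -big_split; apply: eq_bigr => n _ /=.
rewrite /F !termE mulrBr mulr1 addrC subnK 1?ltnW // subnKC 1?ltnW // exprS.
congr (_ + _); rewrite !mulNr mul1r -mulrA -exprD binS bin1.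
by congr (- (_ * _ ^+ _)); nia.
Qed.

Lemma poch_mod5 q m : poch q (5 * m) = poch (q ^+ 5) m *
  \prod_(i < m) ((1 - q ^+ (5 * i + 1)) * (1 - q ^+ (5 * i + 4))) *
  \prod_(i < m) ((1 - q ^+ (5 * i + 2)) * (1 - q ^+ (5 * i + 3))).
Proof.
elim: m => [|m IH]; first by rewrite muln0 /poch !big_ord0 !mulr1.
rewrite (_ : 5 * m.+1 = (5 * m).+4.+1)%N; last lia.
rewrite !pochS IH !big_ord_recr /= -exprM.
have -> : (5 * m.+1 = (5 * m).+4.+1)%N by lia.
by rewrite !addnS !addn0; ring.
Qed.

(** At [k = 0] the factors [ipoch] and [poch] in [rr_alt] cancel and leave the theta series with
    [a = 2]. Its product covers the residues [0, 2, 3] modulo 5, so the residues [1, 4] complete it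
    to [(q)_infinity]. *)
Theorem rogers_ramanujan1 N q m : q ^+ N = 0 -> (2 * N <= m)%N ->
  rr_sum N q 0 *
  \prod_(i < m) ((1 - q ^+ (5 * i + 1)) * (1 - q ^+ (5 * i + 4))) = 1.
Proof.
move=> qN Nm; rewrite rr_sum_alt //.
rewrite (_ : rr_alt N q 0 = poch (q ^+ 5) m *
    \prod_(i < m) ((1 - q ^+ (5 * i + 2)) * (1 - q ^+ (5 * i + 3)))).
  rewrite -mulrA [X in _ * X]mulrAC -poch_mod5 (poch_stable qN); last lia.
  by rewrite mulrC pochK.
rewrite -(theta_prod qN (a := 2)) //; apply: eq_bigr => n _.
by rewrite -mulrA [_ * poch _ _]mulrC pochK // mulr1 /rr_expo !muln0.
Qed.

(** The form [rr_alt1] at [0] is used for [rr_alt] at [1] because there [ipoch] and [poch] cancel;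
    the theta series is the one with [a = 1]. *)
Theorem rogers_ramanujan2 N q m : q ^+ N = 0 -> (2 * N <= m)%N ->
  rr_sum N q 1 *
  \prod_(i < m) ((1 - q ^+ (5 * i + 2)) * (1 - q ^+ (5 * i + 3))) = 1.
Proof.
move=> qN Nm; rewrite rr_sum_alt // -rr_alt1E //.
rewrite (_ : rr_alt1 N q 0 = poch (q ^+ 5) m *
    \prod_(i < m) ((1 - q ^+ (5 * i + 1)) * (1 - q ^+ (5 * i + 4)))).
  rewrite -mulrA -poch_mod5 (poch_stable qN); last lia.
  by rewrite mulrC pochK.
rewrite -(theta_prod qN (a := 1)) //; apply: eq_bigr => n _.
rewrite -mulrA [_ * poch _ _]mulrC pochK // mulr1 /rr_expo.
by congr (_ * _ ^+ _ * (1 - _ ^+ _)); lia.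
Qed.

End RogersRamanujan.

(** * Truncated series *)

(** A sum with a summand outside the set is outside too, so the monomials outside it span an ideal.
    Membership of [0] keeps the quotient nonzero. *)
Record downset (V : nmodType) := Downset {
  downset_fset :> {fset V};
  downset0 : 0 \in downset_fset;
  downsetD : forall a b, a + b \in downset_fset -> a \in downset_fset }.

(* Series modulo the monomials with exponent outside [D]. *)
Definition tring (R : comNzRingType) (V : nmodType) (D : downset V) : Type :=
  {ffun D -> R}.

HB.instance Definition _ (R : comNzRingType) (V : nmodType) (D : downset V) :=
  GRing.Zmodule.copy (tring R D) {ffun D -> R}.

Section TruncatedRing.
Variables (R : comNzRingType) (V : nmodType) (D : downset V).
Implicit Types (f g h : tring R D) (a b e : D) (v w : V) (c : R).

(* [c q^v], which is [0] when [v] is not in [D]. *)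
Definition mono v c : tring R D := [ffun e : D => (v == val e)%:R * c].

Definition tmul f g : tring R D := [ffun e : D =>
  \sum_a \sum_b (val a + val b == val e)%:R * (f a * g b)].

Lemma sum_delta (I : finType) (i0 : I) (F : I -> R) :
  (forall i, i != i0 -> F i = 0) -> \sum_i F i = F i0.
Proof. by move=> F0; rewrite (bigD1 i0) //= big1 ?addr0. Qed.

Lemma tring_mono f : f = \sum_a mono (val a) (f a).
Proof.
apply/ffunP => e; rewrite sum_ffunE (sum_delta (i0 := e)) => [|a ae].
  by rewrite ffunE eqxx mul1r.
by rewrite ffunE (inj_eq val_inj) (negPf ae) mul0r.
Qed.

Lemma tmulDl : left_distributive tmul +%R.
Proof.
move=> f g h; apply/ffunP => e; rewrite !ffunE -big_split; apply: eq_bigr => a _.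
by rewrite -big_split; apply: eq_bigr => b _; rewrite ffunE mulrDl mulrDr.
Qed.

Lemma tmulC : commutative tmul.
Proof.
move=> f g; apply/ffunP => e; rewrite !ffunE exchange_big; apply: eq_bigr => a _.
by apply: eq_bigr => b _; rewrite addrC [f b * _]mulrC.
Qed.

Lemma mono_out v c : v \notin (D : {fset V}) -> mono v c = 0.
Proof.
move=> vD; apply/ffunP => e; rewrite !ffunE; case: eqP => [ve|_]; rewrite ?mul0r //.
by rewrite ve (valP e) in vD.
Qed.

Lemma mono_mul v w c c' : tmul (mono v c) (mono w c') = mono (v + w) (c * c').
Proof.
have tmul0 f : tmul 0 f = 0.
  apply/ffunP => e; rewrite !ffunE big1 // => a _; rewrite big1 // => b _.
  by rewrite ffunE mul0r mulr0.
have [vD|vD] := boolP (v \in (D : {fset V})); last first.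
  by rewrite !(mono_out _ vD, @mono_out (v + w)) //; apply: contra vD; apply: downsetD.
have [wD|wD] := boolP (w \in (D : {fset V})); last first.
  rewrite tmulC (mono_out _ wD) (@mono_out (v + w)) //.
  by apply: contra wD; rewrite addrC; apply: downsetD.
have [a0 ->] : exists a0 : D, v = val a0 by exists [` vD]%fset.
have [b0 ->] : exists b0 : D, w = val b0 by exists [` wD]%fset.
apply/ffunP => e; rewrite !ffunE (sum_delta (i0 := a0)) => [|a aN].
  rewrite (sum_delta (i0 := b0)) => [|b bN]; first by rewrite !ffunE !eqxx !mul1r.
  by rewrite !ffunE !(inj_eq val_inj) [b0 == b]eq_sym (negPf bN) mul0r !mulr0.
by rewrite big1 // => b _; rewrite ffunE !(inj_eq val_inj) [a0 == a]eq_sym (negPf aN) !mul0r mulr0.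
Qed.

Lemma tmul_suml (I : finType) (F : I -> tring R D) g :
  tmul (\sum_i F i) g = \sum_i tmul (F i) g.
Proof.
apply: (big_morph (tmul^~ g)) => [x y|]; first exact: tmulDl.
by apply: (addrI (tmul 0 g)); rewrite -tmulDl !addr0.
Qed.

Lemma tmul_sumr (I : finType) (F : I -> tring R D) g :
  tmul g (\sum_i F i) = \sum_i tmul g (F i).
Proof. by rewrite tmulC tmul_suml; apply: eq_bigr => i _; rewrite tmulC. Qed.

(** By bilinearity it is enough to compare monomials, where [mono_mul] reduces the law to those of
    [V] and [R]. *)
Lemma tmulA : associative tmul.
Proof.
move=> f g h; rewrite [f]tring_mono [g]tring_mono [h]tring_mono.
rewrite !tmul_suml; apply: eq_bigr => a _.
rewrite [LHS]tmul_sumr (tmul_sumr (fun b => mono (val b) (g b)) (mono _ _)) tmul_suml.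
apply: eq_bigr => b _; rewrite !tmul_sumr; apply: eq_bigr => e _.
by rewrite !mono_mul addrA mulrA.
Qed.

Lemma tmul1 : left_id (mono 0 1) tmul.
Proof.
move=> f; rewrite {1}[f]tring_mono tmul_sumr [RHS]tring_mono.
by apply: eq_bigr => a _; rewrite mono_mul add0r mul1r.
Qed.

Lemma tone_neq0 : mono 0 1 != 0.
Proof.
apply/eqP => /ffunP/(_ [` downset0 D]%fset); rewrite !ffunE /= eqxx mul1r.
by move/eqP; rewrite oner_eq0.
Qed.

HB.instance Definition _ := GRing.Zmodule_isComNzRing.Build (tring R D)
  tmulA tmulC tmul1 tmulDl tone_neq0.

Lemma mono_prod (I : finType) (v : I -> V) (c : I -> R) :
  \prod_i mono (v i) (c i) = mono (\sum_i v i) (\prod_i c i).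
Proof.
pose P (x : tring R D) (y : V) (z : R) := x = mono y z.
apply: (big_rec3 P) => // i x y z _ ->.
by rewrite /P -mono_mul.
Qed.

(** The finite counterpart of the definition of [qprod]: expanding the product amounts to choosing
    an exponent in each factor. *)
Lemma coef_prod (I : finType) (f : I -> tring R D) e :
  (\prod_i f i) e = \sum_(phi : {ffun I -> D} | \sum_i val (phi i) == val e)
    \prod_i f i (phi i).
Proof.
rewrite (eq_bigr (fun i => \sum_a mono (val a) (f i a))) => [|i _]; last exact: tring_mono.
rewrite bigA_distr_bigA sum_ffunE [RHS]big_mkcond; apply: eq_bigr => phi _.
by rewrite mono_prod ffunE; case: eqP => _; rewrite ?mul0r ?mul1r.
Qed.

Lemma monoX v n : mono v 1 ^+ n = mono (v *+ n) 1.
Proof.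
by elim: n => [//|n IH]; rewrite exprS IH mulrS -[1 in RHS]mulr1 -mono_mul.
Qed.

End TruncatedRing.

(** * Totally positive integers with bounded conjugates *)

(** The matrices [Bs] commute with [A], hence preserve its eigenspace for [a]; a common eigenvector
    of their restrictions is the required [v]. *)
Lemma common_eigenvector_for (C : numClosedFieldType) n (A : 'M[C]_n)
    (Bs : seq 'M[C]_n) (a : C) :
  eigenvalue A a -> {in Bs, forall B, comm_mx A B} ->
  {in Bs &, forall B B', comm_mx B B'} ->
  exists v : 'rV_n, [/\ v != 0, v *m A = a *: v & all (fun B => stablemx v B) Bs].
Proof.
move=> Aa AB BB.
have stabE B : B \in Bs -> stablemx (eigenspace A a) B.
  by move=> hB; rewrite comm_mx_stable_eigenspace //; apply: AB.
have [||v v0 vP] :=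
  @common_eigenvector C _ [seq restrictmx (eigenspace A a) B | B <- Bs].
- by rewrite lt0n mxrank_eq0.
- move=> _ _ /mapP[/= B hB ->] /mapP[/= B' hB' ->].
  by rewrite /comm_mx -!conjmxM ?inE ?stablemx_row_base ?stabE // BB.
exists (v *m row_base (eigenspace A a)); split.
- by rewrite mulmx_free_eq0 ?row_base_free.
- by apply/eigenspaceP; rewrite mulmx_sub // eq_row_base.
- apply/allP => B hB; rewrite -stablemx_restrict ?stabE //.
  by apply: (allP vP); apply/mapP; exists B.
Qed.

(** * Embeddings from eigenvalues of the regular representation *)

Section Embedding.
Variables (C : numClosedFieldType) (K : fieldExtType rat).
Variables (n' : nat).
Local Notation n := n'.+1.
Variable b : n.-tuple K.
Hypothesis bK : basis_of fullv b.

Definition coord_row (x : K) : 'rV[rat]_n := \row_i coord b i x.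
Definition row_coord (u : 'rV[rat]_n) : K := \sum_i u 0 i *: b`_i.

Lemma coord_rowK : cancel coord_row row_coord.
Proof.
move=> x; rewrite /row_coord [RHS](coord_basis bK (memvf x)).
by apply: eq_bigr => i _; rewrite mxE.
Qed.

Lemma row_coordK : cancel row_coord coord_row.
Proof.
move=> u; apply/rowP => i; rewrite mxE.
by rewrite coord_sum_free // (basis_free bK).
Qed.

Fact coord_row_is_linear : linear coord_row.
Proof. by move=> a x y; apply/rowP => i; rewrite !mxE linearP. Qed.
HB.instance Definition _ :=
  GRing.isLinear.Build rat K 'rV[rat]_n _ coord_row coord_row_is_linear.

Fact row_coord_is_linear : linear row_coord.
Proof. by apply: can2_linear coord_rowK row_coordK. Qed.
HB.instance Definition _ :=
  GRing.isLinear.Build rat 'rV[rat]_n K _ row_coord row_coord_is_linear.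

Definition regmx (x : K) : 'M[rat]_n :=
  \matrix_i coord_row (row_coord (delta_mx 0 i) * x).

Lemma mul_regmx u x : u *m regmx x = coord_row (row_coord u * x).
Proof.
rewrite mulmx_sum_row {2}[u]matrix_sum_delta big_ord1 !linear_sum /= mulr_suml.
rewrite linear_sum; apply: eq_bigr => i _.
by rewrite rowK !linearZ /= -scalerAl linearZ.
Qed.

Lemma eq_regmx (x : K) (B : 'M[rat]_n) :
  (forall u, u *m B = coord_row (row_coord u * x)) -> B = regmx x.
Proof. by move=> h; apply/row_matrixP => i; rewrite !rowE h mul_regmx. Qed.

Lemma regmx_is_additive : zmod_morphism regmx.
Proof.
move=> x y; apply/esym/eq_regmx => u.
by rewrite mulmxBr !mul_regmx mulrBr linearB.
Qed.

Lemma regmx_is_multiplicative : monoid_morphism regmx.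
Proof.
split=> [|x y]; apply/esym/eq_regmx => u.
  by rewrite mulr1 row_coordK mulmx1.
by rewrite -[regmx x * _]/(_ *m _) mulmxA !mul_regmx coord_rowK mulrA.
Qed.

HB.instance Definition _ := GRing.isZmodMorphism.Build K 'M[rat]_n regmx regmx_is_additive.
HB.instance Definition _ := GRing.isMonoidMorphism.Build K 'M[rat]_n regmx regmx_is_multiplicative.

Lemma regmx_comm x y : comm_mx (regmx x) (regmx y).
Proof.
by rewrite /comm_mx -[LHS](rmorphM regmx x y) -[RHS](rmorphM regmx y x) mulrC.
Qed.

Lemma regmx_sum (x : K) : regmx x = \sum_i coord b i x *: regmx b`_i.
Proof.
apply/esym/eq_regmx => u; rewrite mulmx_sumr [in RHS](coord_basis bK (memvf x)).
rewrite mulr_sumr linear_sum; apply: eq_bigr => i _.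
by rewrite -scalemxAr mul_regmx -scalerAr linearZ.
Qed.

Lemma regmx_alg (a : rat) : regmx (a%:A) = a%:M.
Proof.
by apply/esym/eq_regmx => u; rewrite mulr_algr linearZ /= row_coordK mul_mx_scalar.
Qed.

Lemma horner_regmx (p : {poly rat}) x :
  horner_mx (regmx x) p = regmx (map_poly (in_alg K) p).[x].
Proof.
elim/poly_ind: p => [|p a IH]; first by rewrite !rmorph0 horner0 rmorph0.
rewrite !rmorphD !rmorphM /= map_polyX map_polyC /= hornerMXaddC rmorphD rmorphM.
by rewrite horner_mx_X horner_mx_C IH /= regmx_alg.
Qed.

(** [regmx] is a ring morphism on a field, hence injective, so [p] kills [regmx x] exactly when it
    kills [x]. *)
Lemma root_regmx_min (p : {poly rat}) x :
  (mxminpoly (regmx x) %| p) = root (map_poly (in_alg K) p) x.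
Proof.
apply/idP/idP => [/dvdpP[q ->]|/rootP px0].
  rewrite rmorphM rootM; apply/orP; right; apply/rootP.
  have /esym/eqP := horner_regmx (mxminpoly (regmx x)) x.
  by rewrite mx_root_minpoly fmorph_eq0 => /eqP.
by apply: mxminpoly_min; rewrite horner_regmx px0 raddf0.
Qed.

Let M (x : K) : 'M[C]_n := map_mx ratr (regmx x).

(** All [M x] commute, so they have a common eigenvector [v] on which [M e] acts by [w]. The
    eigenvalue of [M x] on [v] is a ring morphism in [x]. *)
Lemma embedding_of_eigenvalue (e : K) (w : C) :
  root (map_poly ratr (mxminpoly (regmx e))) w ->
  exists sigma : {rmorphism K -> C}, sigma e = w.
Proof.
move=> w_root.
have w_eigen : eigenvalue (M e) w by rewrite eigenvalue_root_min mxminpoly_map.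
have M_comm x y : comm_mx (M x) (M y).
  by rewrite /comm_mx -!map_mxM regmx_comm.
have [||v [v0 ve vb]] := @common_eigenvector_for C n (M e) [seq M x | x <- b] w w_eigen.
- by move=> _ /mapP[x _ ->].
- by move=> _ _ /mapP[x _ ->] /mapP[y _ ->].
(* Stability under the finitely many [M x] with [x] in the basis suffices, since every [M x] is a
   linear combination of them. *)
have vM x : {a | v *m M x = a *: v}.
  apply/cid/sub_rVP.
  have -> : M x = \sum_i ratr (coord b i x) *: M b`_i.
    rewrite /M regmx_sum map_mx_sum; apply: eq_bigr => i _.
    by rewrite map_mxZ.
  rewrite mulmx_sumr summx_sub // => i _; rewrite -scalemxAr scalemx_sub //.
  by apply: (allP vb); rewrite map_f // mem_nth // size_tuple.
have vI a a' : a *: v = a' *: v -> a = a'.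
  move=> h; apply/eqP; rewrite -subr_eq0.
  have /eqP : (a - a') *: v = 0 by rewrite scalerBl h subrr.
  by rewrite scaler_eq0 (negPf v0) orbF.
pose sigma x := sval (vM x).
have sE x : v *m M x = sigma x *: v by exact: (svalP (vM x)).
have sB : zmod_morphism sigma.
  move=> x y; apply: vI; rewrite scalerBl -!sE /M -mulmxBr -map_mxB.
  by congr (_ *m map_mx _ _); apply: regmx_is_additive.
have sM : monoid_morphism sigma.
  split=> [|x y]; apply: vI; rewrite -sE /M.
    by rewrite (regmx_is_multiplicative.1) map_mx1 mulmx1 scale1r.
  rewrite (regmx_is_multiplicative.2) -[regmx x * _]/(_ *m _) map_mxM mulmxA.
  by rewrite sE -scalemxAl sE scalerA.
pose sigma1 := GRing.isZmodMorphism.Build K C sigma sB.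
pose sigma2 := GRing.isMonoidMorphism.Build K C sigma sM.
pose sigmaR : {rmorphism K -> C} := HB.pack sigma sigma1 sigma2.
by exists sigmaR; apply: vI; rewrite /= -sE.
Qed.

End Embedding.

Section NumberField.
Variables (K : fieldExtType rat).

(* By Gauss' lemma the minimal polynomial of an algebraic integer has integral
   coefficients. *)
Lemma integral_embeddings (C : numClosedFieldType) (e : K) :
  integralOver (intr : int -> K) e ->
  exists p : {poly int}, [/\ p \is monic, (size p <= (\dim {:K}).+1)%N,
    root (map_poly intr p) e &
    forall w : C, root (map_poly intr p) w ->
      exists sigma : {rmorphism K -> C}, sigma e = w].
Proof.
case=> P P_monic Pe.
have : basis_of fullv (vbasis {:K}) by exact: vbasisP.
have : (0 < \dim {:K})%N by rewrite adim_gt0.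
move: (vbasis {:K}); case: (\dim {:K}) => // n' b _ bK.
pose m := mxminpoly (regmx b e).
have intr_alg (p : {poly int}) : map_poly (in_alg K) (map_poly intr p) = map_poly intr p.
  by rewrite -map_poly_comp; apply: eq_map_poly => z /=; rewrite scaler_int.
have intr_ratr (p : {poly int}) : map_poly (ratr : rat -> C) (map_poly intr p) =
    map_poly intr p.
  by rewrite -map_poly_comp; apply: eq_map_poly => z /=; rewrite ratr_int.
have : m %| map_poly intr P by rewrite root_regmx_min ?intr_alg.
move=> /dvdpP_rat_int[p [a a0 mE] [r PE]].
(* The leading coefficient of [p] divides that of the monic [P], so it is a sign, and scaling [p] by
   it gives a monic polynomial. *)
have ll : lead_coef p * lead_coef p = 1.
  have /(congr1 absz) : lead_coef p * lead_coef r = 1.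
    by rewrite -lead_coefM -PE; apply/eqP.
  by rewrite abszM => /eqP; rewrite muln_eq1 => /andP[/eqP h _]; nia.
have l0 : lead_coef p != 0 by apply: contra_eq_neq ll => ->; rewrite mul0r.
have size_p : size p = size m.
  by rewrite mE size_scale // size_map_poly_id0 // intr_eq0.
have pm : map_poly intr (lead_coef p *: p) = (lead_coef p)%:~R / a *: m.
  by rewrite mE scalerA divfK // map_polyZ.
have c0 : (lead_coef p)%:~R / a != 0 by rewrite mulf_neq0 ?invr_eq0 ?intr_eq0.
exists (lead_coef p *: p); split.
- by rewrite monicE lead_coefZ ll.
- rewrite size_scale // size_p -(size_char_poly (regmx b e)).
  by rewrite dvdp_leq ?mxminpoly_dvd_char // monic_neq0 ?char_poly_monic.
- by rewrite -intr_alg -(root_regmx_min bK) pm dvdpZr.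
- move=> w; rewrite -intr_ratr pm map_polyZ rootZ ?fmorph_eq0 //.
  exact: embedding_of_eigenvalue.
Qed.

End NumberField.

(** Each factor [X - w] multiplies the bound on the coefficients by at most [1 + B]. *)
Lemma prod_XsubC_coef_bound (C : numDomainType) (B : C) (s : seq C) i :
  0 <= B -> {in s, forall w, `|w| <= B} ->
  `|(\prod_(w <- s) ('X - w%:P))`_i| <= (1 + B) ^+ size s.
Proof.
move=> B0; elim: s i => [|w s IH] i hs.
  by rewrite big_nil coef1 expr0 normr_nat lern1 leq_b1.
have hs' : {in s, forall w, `|w| <= B} by move=> x xs; rewrite hs // inE xs orbT.
rewrite big_cons mulrBl coefB coefXM coefCM /= exprS mulrDl mul1r.
apply: le_trans (ler_normB _ _) (lerD _ _); last first.
  by rewrite normrM ler_pM ?IH // hs ?mem_head.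
by case: eqP => _; rewrite ?IH // normr0 exprn_ge0 // addr_ge0.
Qed.

Lemma finite_roots (F : idomainType) (p : {poly F}) :
  p != 0 -> finite_set [set x | root p x].
Proof.
move=> p0; apply: contrapT => /(@infinite_set_fset _ _ (size p))[B Bp].
rewrite leqNgt => /negP; apply; apply: max_poly_roots; rewrite ?fset_uniq //.
by apply/allP => x xB; apply: (Bp x).
Qed.

Lemma finite_bounded_roots (F : idomainType) (n T : nat) :
  finite_set [set x : F | exists p : {poly int}, [/\ p \is monic, (size p <= n)%N,
    forall i, (absz (p`_i)%R <= T)%N & root (map_poly intr p) x]].
Proof.
(* Coefficients in [[-T, T]] are encoded as ordinals by adding [T], so these polynomials form a
   finite family. *)
pose P (t : {ffun 'I_n -> 'I_(2 * T).+1}) : {poly int} :=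
  \poly_(i < n) (if insub i is Some j then (t j)%:Z - T%:Z else 0).
apply: (@sub_finite_set _ _
  (\bigcup_(t in [set t | P t \is monic]) [set x : F | root (map_poly intr (P t)) x])).
  move=> x [p [p1 pn pT px]].
  pose t := [ffun j : 'I_n => inord (absz (p`_j + T%:Z)) : 'I_(2 * T).+1].
  have PE : P t = p.
    apply/polyP => i; rewrite coef_poly; case: ltnP => ni; last first.
      by rewrite nth_default // (leq_trans pn).
    by rewrite insubT /= ffunE /=; move: (p`_i) (pT i) => c hc; rewrite inordK; lia.
  by exists t; rewrite /= PE.
apply: bigcup_finite => [|t Pt]; first exact: finite_finset.
by apply/finite_roots/monic_neq0/monic_map.
Qed.

(** * Real embeddings of a totally real field *)

Section TotallyReal.
Local Open Scope complex_scope.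
Variables (R : realType) (K : fieldExtType rat).
Hypothesis K_real : totally_real R K.

Lemma real_embedding (sigma : {rmorphism K -> R[i]}) :
  exists tau : {rmorphism K -> R}, forall x, sigma x = (tau x)%:C.
Proof.
pose tau x := complex.Re (sigma x).
have tauE x : sigma x = (tau x)%:C by rewrite /tau RRe_real.
have tauB : zmod_morphism tau.
  by move=> x y; apply: complexI; rewrite rmorphB /= -!tauE rmorphB.
have tauM : monoid_morphism tau.
  split=> [|x y]; apply: complexI; first by rewrite -tauE !rmorph1.
  by rewrite rmorphM /= -!tauE rmorphM.
pose tau1 := GRing.isZmodMorphism.Build K R tau tauB.
pose tau2 := GRing.isMonoidMorphism.Build K R tau tauM.
pose tauR : {rmorphism K -> R} := HB.pack tau tau1 tau2.
by exists tauR => x; rewrite tauE.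
Qed.

(** Without an embedding total positivity would be vacuous and [0] would satisfy it. A monic
    polynomial with root [1] is not constant, and a complex root of the one given by
    [integral_embeddings] yields an embedding. *)
Lemma embedding_exists : inhabited {rmorphism K -> R}.
Proof.
have /(integral_embeddings R[i])[p [p1 _ pe root_emb]] : integralOver (intr : int -> K) 1.
  exact: integral1.
have p_size : size (map_poly (intr : int -> R[i]) p) != 1%N.
  rewrite size_map_poly_id0 ?(monicP p1) ?oner_eq0 //.
  apply: contraTneq pe => /eqP/size_poly1P[c c0 pc].
  move: p1; rewrite pc monicE lead_coefC => /eqP ->.
  by rewrite map_polyC /= rootC oner_eq0.
have [w /root_emb[sigma _]] := closed_rootP _ p_size.
by have [tau _] := real_embedding sigma; constructor.
Qed.

(** All conjugates of [d] are roots of one monic polynomial, which is positive beyond some bound. *)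
Lemma embedding_bound (d : K) : integralOver (intr : int -> K) d ->
  exists B : nat, forall tau : {rmorphism K -> R}, tau d <= B%:R.
Proof.
case=> p p1 pd.
have [B hB] := @monic_Cauchy_bound R (map_poly intr p) (monic_map _ p1).
exists (Num.bound `|B|) => tau; rewrite leNgt; apply/negP => lt_d.
have /hB : B <= tau d.
  by apply/ltW/(lt_trans _ lt_d)/(le_lt_trans (ler_norm B))/archi_boundP/normr_ge0.
suff -> : (map_poly intr p).[tau d] = 0 by rewrite ltxx.
have <- : map_poly tau (map_poly intr p) = map_poly intr p.
  by rewrite -map_poly_comp; apply: eq_map_poly => z /=; rewrite rmorph_int.
by rewrite horner_map (rootP pd) rmorph0.
Qed.

(** Every complex root of the polynomial [p] of [e] is a value of an embedding, which is real, so
    [B] bounds the roots and [(1 + B)^n] the coefficients. Finitely many [p] remain. *)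
Lemma embeddings_bound_finite (B : nat) :
  finite_set [set e : K | integralOver (intr : int -> K) e /\
    forall tau : {rmorphism K -> R}, `|tau e| <= B%:R].
Proof.
set n := (\dim {:K}).+1.
apply: (@sub_finite_set _ _ _ _ (@finite_bounded_roots K n ((1 + B) ^ n))).
move=> e [/(integral_embeddings R[i])[p [p1 pn pe root_emb]] eB].
exists p; split=> // i.
have [s ps] := closed_field_poly_normal (map_poly (intr : int -> R[i]) p).
have lead1 : lead_coef (map_poly (intr : int -> R[i]) p) = 1.
  exact/monicP/monic_map.
rewrite lead1 scale1r in ps.
have sB : {in s, forall w, `|w| <= B%:R :> R[i]}.
  move=> w ws.
  have /root_emb[sigma <-] : root (map_poly (intr : int -> R[i]) p) w.
    by rewrite ps root_prod_XsubC.
  have [tau ->] := real_embedding sigma.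
  rewrite normc_def /= expr0n /= addr0 sqrtr_sqr.
  have -> : B%:R = (B%:R : R)%:C by rewrite rmorph_nat.
  by rewrite lecR eB.
have := prod_XsubC_coef_bound i (ler0n _ B) sB.
rewrite -ps coef_map /= -intr_norm => h.
have sn : (size s <= n)%N.
  have size_p : size p = (size s).+1.
    rewrite -[RHS](size_prod_XsubC s id) -ps size_map_poly_id0 //.
    by rewrite (monicP p1) oner_eq0.
  by rewrite size_p in pn; apply: ltnW.
have : `|p`_i|%:~R <= ((1 + B) ^ n)%:R :> R[i].
  apply: le_trans h _; rewrite natrX natrD ler_weXn2l //.
  by rewrite lerDl ler0n.
by rewrite [X in _ <= X]pmulrn ler_int -abszE.
Qed.

End TotallyReal.

(** * The monoid of exponents *)

Section Exponents.
Variables (R : realType) (K : fieldExtType rat).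
Hypothesis K_real : totally_real R K.
Local Notation H := (expo R K).
Implicit Types (d e c t : H).

Lemma expo_val_inj : injective (@expo_val R K).
Proof. exact: val_inj. Qed.

Lemma expo_valD d e : expo_val (d + e) = expo_val d + expo_val e.
Proof. by []. Qed.

Lemma expo_valMn d n : expo_val (d *+ n) = expo_val d *+ n.
Proof. by elim: n => [//|n IH]; rewrite !mulrS expo_valD IH. Qed.

Lemma expo_val_integral d : integralOver (intr : int -> K) (expo_val d).
Proof. by case: d => x /= /asboolP[->|[]//]; apply: integral0. Qed.

Lemma expo_val_ge0 d (tau : {rmorphism K -> R}) : 0 <= tau (expo_val d).
Proof. by case: d => x /= /asboolP[->|[_ /(_ tau)/ltW//]]; rewrite rmorph0. Qed.

Lemma pos_expoE d : pos_expo d <-> d <> 0.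
Proof.
case: d => x xP; split=> [[_ xpos] /(congr1 (@expo_val R K))/= x0|x0].
  have [tau] := embedding_exists K_real.
  by have := xpos tau; rewrite /= x0 rmorph0 ltxx.
have /asboolP[x0'|//] := xP.
by case: x0; apply: expo_val_inj.
Qed.

Lemma expo_mulrn_inj c m n : c != 0 -> c *+ m = c *+ n -> m = n.
Proof.
move=> c0 /(congr1 (@expo_val R K)); rewrite !expo_valMn => /eqP.
have v0 : expo_val c != 0.
  by apply: contra c0 => /eqP cv; apply/eqP; apply: expo_val_inj.
rewrite -mulr_natr -[X in _ == X]mulr_natr (inj_eq (mulfI v0)) => /eqP.
rewrite -!(rmorph_nat (in_alg K)) => /(fmorph_inj (in_alg K)) /eqP.
by rewrite eqr_nat => /eqP.
Qed.

Lemma expo_mulrnI n : (0 < n)%N -> injective (fun d => d *+ n).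
Proof.
move=> n0 d e /(congr1 (@expo_val R K)); rewrite !expo_valMn.
rewrite -mulr_natr -[X in _ = X]mulr_natr => h; apply: expo_val_inj; apply: mulIf h.
by rewrite -(rmorph_nat (in_alg K)) fmorph_eq0 pnatr_eq0 -lt0n.
Qed.

(** The conjugates of a summand of [d] lie between [0] and those of [d]. *)
Lemma expo_le_finite d : finite_set [set e | exists e', e + e' = d].
Proof.
have [B hB] := embedding_bound R (expo_val_integral d).
have := embeddings_bound_finite K_real B.
move=> /(@finite_preimage _ _ _ (@expo_val R K))-/(_ (in2W expo_val_inj)).
apply: sub_finite_set => e [e' ee'] /=; split=> [|tau].
  exact: expo_val_integral.
rewrite ger0_norm ?expo_val_ge0 //; apply: le_trans (hB tau).
by rewrite -ee' expo_valD rmorphD lerDl expo_val_ge0.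
Qed.

Lemma expo_downset_proof d :
  let D := fset_set [set e | exists e', e + e' = d] in
  [/\ 0 \in D, d \in D & forall a b, a + b \in D -> a \in D].
Proof.
move=> D; split=> [||a b]; rewrite !in_fset_set; try exact: expo_le_finite.
- by apply/mem_set; exists d; rewrite add0r.
- by apply/mem_set; exists 0; rewrite addr0.
- by move=> /set_mem[e' <-]; apply/mem_set; exists (b + e'); rewrite addrA.
Qed.

Lemma expo_downset d : exists D : downset H, d \in (D : {fset H}).
Proof.
have [D0 dD DD] := expo_downset_proof d.
by exists (Downset D0 DD).
Qed.

(** Otherwise [D] would contain the [n + 1] distinct multiples [c *+ i], [i <= n]. Hence [q^c] is
    nilpotent in the truncated ring, with exponent the cardinal of [D]. *)
Lemma mulrn_notin_downset (D : downset H) c n : c != 0 -> (#|` D| <= n)%N ->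
  c *+ n \notin (D : {fset H}).
Proof.
move=> c0 Dn; apply/negP => cD.
have sub : {subset [seq c *+ i | i <- iota 0 n.+1] <= (D : {fset H})}.
  move=> _ /mapP[i ii ->]; rewrite mem_iota add0n ltnS in ii.
  by apply: (@downsetD _ D _ (c *+ (n - i))); rewrite -mulrnDr subnKC.
have := uniq_leq_size _ sub; rewrite size_map size_iota leqNgt => /(_ _)/negP[] //.
by rewrite map_inj_in_uniq ?iota_uniq // => i j _ _; apply: expo_mulrn_inj.
Qed.

(** Take the largest [s] dividing [d]; it is bounded because a downset containing [d] is finite. If
    [t] were [e *+ n] with [n >= 2], then [n * s] would be larger. *)
Lemma exists_primitive_factor d : d != 0 ->
  exists t s, [/\ primitive t, (0 < s)%N & d = t *+ s].
Proof.
move=> d0; have [D dD] := expo_downset d.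
pose P s := (0 < s)%N && `[< exists t, d = t *+ s >].
have P1 : exists s, P s by exists 1%N; apply/asboolP; exists d.
have PD s : P s -> (s <= #|` D|)%N.
  move=> /andP[s0 /asboolP[t dt]].
  rewrite leqNgt; apply/negP => Ds.
  have t0 : t != 0 by apply: contra_neq d0 => t0; rewrite dt t0 mul0rn.
  move: (mulrn_notin_downset t0 (ltnW Ds)).
  by rewrite -dt dD.
case: (ex_maxnP P1 PD) => s /andP[s0 /asboolP[t dt]] smax.
have t0 : t != 0 by apply: contra_neq d0 => t0; rewrite dt t0 mul0rn.
exists t, s; split=> //; split; first exact/pos_expoE/eqP.
move=> n n2 [e _ te]; have /smax : P (n * s)%N.
  apply/andP; split; first by rewrite muln_gt0 s0 (leq_trans _ n2).
  by apply/asboolP; exists e; rewrite dt te mulrnA.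
by rewrite leqNgt ltn_Pmull.
Qed.

(* By Bezout [t / b] is an integral combination of [t] and [t']. *)
Lemma primitive_coprime t t' (a b : nat) : primitive t -> primitive t' ->
  (0 < a)%N -> (0 < b)%N -> coprime a b -> t *+ a = t' *+ b -> b = 1%N.
Proof.
move=> [tpos tprim] [t'pos _] a0 b0 ab tt'.
case: b b0 ab tt' => // -[//|b] _ ab tt'; case: (tprim b.+2) => //.
have [u v uv _] := egcdnP b.+2 a0.
have {}uv : (u * a = v * b.+2 + 1)%N by rewrite uv (eqP ab).
pose x : K := expo_val t' *+ u - expo_val t *+ v.
have xb : x *+ b.+2 = expo_val t.
  rewrite mulrnBl -!mulrnA [(u * _)%N]mulnC mulrnA -expo_valMn -tt' expo_valMn.
  by rewrite -mulrnA mulnC uv addn1 mulrSr addrAC subrr add0r.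
have xint : algebraic_integer x.
  by apply: integral_sub; rewrite -expo_valMn; apply: expo_val_integral.
have xpos : totally_positive R x.
  by move=> tau; have := tpos.2 tau; rewrite -xb rmorphMn pmulrn_lgt0.
have xO : x \in in_expo R K by apply/asboolP; right; split.
by exists (Expo xO); [exact: conj xint xpos|apply: expo_val_inj; rewrite expo_valMn xb].
Qed.

(** After division by [gcdn s s'], [primitive_coprime] applied in both directions shows that both
    quotients are [1]. *)
Lemma primitive_mulrn_inj t t' (s s' : nat) : primitive t -> primitive t' ->
  (0 < s)%N -> (0 < s')%N -> t *+ s = t' *+ s' -> t = t' /\ s = s'.
Proof.
move=> pt pt' s0 s'0 tt'.
pose g := gcdn s s'; have g0 : (0 < g)%N by rewrite gcdn_gt0 s0.
have sE : s = (s %/ g * g)%N by rewrite divnK // dvdn_gcdl.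
have s'E : s' = (s' %/ g * g)%N by rewrite divnK // dvdn_gcdr.
have a0 : (0 < s %/ g)%N by rewrite divn_gt0 // dvdn_leq // dvdn_gcdl.
have b0 : (0 < s' %/ g)%N by rewrite divn_gt0 // dvdn_leq // dvdn_gcdr.
have co : coprime (s %/ g) (s' %/ g).
  by rewrite /coprime -(eqn_pmul2r g0) muln_gcdl -sE -s'E mul1n.
have tt : t *+ (s %/ g) = t' *+ (s' %/ g).
  by apply: (expo_mulrnI g0); rewrite -!mulrnA -sE -s'E.
have b1 := primitive_coprime pt pt' a0 b0 co tt.
have a1 : (s %/ g)%N = 1%N.
  by apply: (primitive_coprime pt' pt b0 a0 _ (esym tt)); rewrite coprime_sym.
by rewrite a1 b1 in tt; split=> //; rewrite sE s'E a1 b1.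
Qed.

Lemma scaleE t s : primitive t -> (0 < s)%N -> scale (t *+ s) = s.
Proof.
move=> pt s0; apply: xget_subset1; first by split=> //; exists t.
move=> x y [x0 [u pu ux]] [y0 [w pw wy]].
by have [] := primitive_mulrn_inj pu pw x0 y0 (etrans (esym ux) wy).
Qed.

End Exponents.

(** * Series and infinite products *)

Section Truncation.
Variables (R : realType) (K : fieldExtType rat).
Hypothesis K_real : totally_real R K.
Local Notation H := (expo R K).
Implicit Types (f g h : qsum R K) (c d : H).

(** * Truncation to a downset *)

Section TruncationAt.
Variable D : downset H.
Let N := #|` D|.

Definition trunc f : tring R D := [ffun e : D => f (val e)].

Lemma truncB f g : trunc (f - g) = trunc f - trunc g.
Proof. by apply/ffunP => e; rewrite !ffunE. Qed.

Lemma truncX d : trunc (qX d) = mono D d 1.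
Proof. by apply/ffunP => e; rewrite !ffunE mulr1 eq_sym. Qed.

Lemma trunc1 : trunc qone = 1.
Proof. exact: truncX. Qed.

(** If [a + b] lies in [D] then so do [a] and [b], so the whole convolution at an exponent of [D]
    takes place inside [D]. *)
Lemma trunc_mul f g : trunc (qmul f g) = trunc f * trunc g.
Proof.
apply/ffunP => e; rewrite !ffunE /qmul.
pose r := [seq (a, b) | a <- (D : {fset H}), b <- (D : {fset H})].
have r_uniq : uniq r.
  by apply: allpairs_uniq; rewrite ?fset_uniq // => -[? ?] [? ?] _ _ [-> ->].
transitivity (\sum_(p <- r | p.1 + p.2 == val e) f p.1 * g p.2).
  rewrite [RHS]bigfs // => [|p /eqP pe]; first by apply: eq_fsbigl; apply/seteqP; split=> p /eqP.
  case/negP; apply/allpairsP; exists p; split=> //; last by case: p {pe}.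
    by apply: (@downsetD _ D _ p.2); rewrite pe (valP e).
  by apply: (@downsetD _ D _ p.1); rewrite addrC pe (valP e).
rewrite big_mkcond /r big_allpairs big_seq_fsetE; apply: eq_bigr => a _.
rewrite big_seq_fsetE; apply: eq_bigr => b _; rewrite !ffunE.
by case: eqP => _; rewrite ?mul1r ?mul0r.
Qed.

Lemma trunc_series (f : nat -> qsum R K) n :
  (forall i, (n <= i)%N -> trunc (f i) = 0) ->
  trunc (qseries f) = \sum_(i < n) trunc (f i).
Proof.
move=> f0; apply/ffunP => e; rewrite ffunE sum_ffunE /qseries.
rewrite (eq_bigr (fun i : 'I_n => f i (val e))) => [|i _]; last by rewrite ffunE.
rewrite (fsbig_ord _ n (fun i => f i (val e))); apply/esym/fsbig_widen => // i [_ /= ni].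
have /f0/ffunP/(_ e) : (n <= i)%N by rewrite leqNgt; apply/negP.
by rewrite !ffunE.
Qed.

Lemma monoX_eq0 c : c != 0 -> mono D c (1 : R) ^+ N = 0.
Proof.
by move=> c0; rewrite monoX mono_out //; apply: mulrn_notin_downset.
Qed.

Lemma trunc_geom c : c != 0 -> trunc (qgeom c) = geom N (mono D c 1).
Proof.
move=> c0; rewrite (@trunc_series _ N) => [|i Ni].
  by apply: eq_bigr => i _; rewrite truncX monoX.
by rewrite truncX -monoX (exp_nilp (monoX_eq0 c0)).
Qed.

Lemma trunc_geom_mulrn c n : c != 0 -> (0 < n)%N ->
  trunc (qgeom (c *+ n)) = geom N (mono D c 1 ^+ n).
Proof.
move=> c0 n0; rewrite monoX trunc_geom // -(mulr0n c).
by apply/eqP => /(expo_mulrn_inj c0) n0'; rewrite n0' in n0.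
Qed.

Lemma trunc_prod (I : Type) (r : seq I) (F : I -> qsum R K) :
  trunc (\big[@qmul R K/qone]_(i <- r) F i) = \prod_(i <- r) trunc (F i).
Proof.
by apply: (big_morph trunc) => [f g|]; [exact: trunc_mul|exact: trunc1].
Qed.

Lemma trunc_eq1 f : trunc f = 1 -> f 0 = 1.
Proof.
move=> /ffunP/(_ [` downset0 D]%fset).
by rewrite -trunc1 !ffunE /= /qone /qX eqxx.
Qed.

Lemma trunc_qprod (J : choiceType) (A : set J) (F : J -> qsum R K) (s : seq J) :
  uniq s -> {in s, forall j, A j} -> (forall j, A j -> F j 0 = 1) ->
  (forall j, A j -> j \notin s -> trunc (F j) = 1) ->
  trunc (qprod A F) = \prod_(j <- s) trunc (F j).
Proof.
move=> s_uniq sA F0 Fout.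
pose X := [fset j in s]%fset; pose T : finType := X.
have memX j : (j \in X) = (j \in s) by rewrite inE.
have -> : \prod_(j <- s) trunc (F j) = \prod_(j : T) trunc (F (val j)).
  transitivity (\prod_(j <- X) trunc (F j)); last exact: big_seq_fsetE.
  by apply: perm_big; apply: uniq_perm; rewrite ?s_uniq ?fset_uniq.
apply/ffunP => e; rewrite ffunE coef_prod.
(* A function [phi] on [s] encodes the set of the pairs [(j, phi j)] with [phi j <> 0]. *)
pose L (phi : {ffun T -> D}) :=
  [seq (val j, val (phi j)) | j <- index_enum T & val (phi j) != 0].
have L_uniq (phi : {ffun T -> D}) : uniq (L phi).
  rewrite map_inj_uniq ?filter_uniq ?index_enum_uniq // => i j [ij _].
  exact: val_inj.
pose S (phi : {ffun T -> D}) := [fset p in L phi]%fset.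
have memS (phi : {ffun T -> D}) (p : J * H) :
    reflect (exists j : T, val (phi j) != 0 /\ p = (val j, val (phi j))) (p \in S phi).
  rewrite inE; apply: (iffP mapP) => [[j]|[j [jphi ->]]].
    by rewrite mem_filter => /andP[jphi _] ->; exists j.
  by exists j => //; rewrite mem_filter jphi mem_index_enum.
have permS (phi : {ffun T -> D}) : perm_eq (S phi) (L phi).
  by apply: uniq_perm; rewrite ?fset_uniq ?L_uniq //; move=> p; rewrite inE.
have sumS (phi : {ffun T -> D}) : \sum_(p <- S phi) p.2 = \sum_j val (phi j).
  rewrite (perm_big _ (permS phi)) big_map big_filter /= big_mkcond.
  by apply: eq_bigr => j _; case: eqP.
have prodS (phi : {ffun T -> D}) : \prod_(p <- S phi) F p.1 p.2 = \prod_j trunc (F (val j)) (phi j).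
  rewrite (perm_big _ (permS phi)) big_map big_filter /= big_mkcond.
  apply: eq_bigr => j _; rewrite ffunE; case: eqP => //= ->.
  by rewrite F0 //; apply: sA; rewrite -memX; apply: valP.
pose Q := [set U : {fset J * H} |
  [/\ forall p, p \in U -> p.1 \in s /\ pos_expo p.2,
      {in U &, injective fst} & \sum_(p <- U) p.2 = val e]].
have memD (U : {fset J * H}) p : p \in U -> \sum_(p <- U) p.2 = val e ->
    p.2 \in (D : {fset H}).
  move=> pU Ue; apply: (@downsetD _ D _ (\sum_(q <- (U `\ p)%fset) q.2)).
  by move: Ue; rewrite (big_fsetD1 p pU) /= => ->; apply: valP.
transitivity (\sum_(U \in Q) \prod_(p <- U) F p.1 p.2).
  apply/esym/fsbig_widen => [U [UQ Uinj Usum]|U [[UA Uinj Usum] UQ]].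
    by split=> // p /UQ[/sA].
  have [p [pU ps]] : exists p, p \in U /\ p.1 \notin s.
    apply: contrapT => hU; apply: UQ; split=> // p pU.
    split; last by case: (UA p pU).
    by apply: contrapT => /negP ps; apply: hU; exists p.
  have [pA ppos] := UA p pU.
  have pD := memD U p pU Usum.
  rewrite /= (big_fsetD1 p pU) /=.
  have /ffunP/(_ [` pD]%fset) := Fout _ pA ps.
  rewrite -trunc1 !ffunE /= /qone /qX => ->.
  have /eqP/negPf -> : p.2 <> 0 by apply/pos_expoE.
  by rewrite mul0r.
rewrite (reindex_fsbig S [set phi | \sum_j val (phi j) == val e]); last first.
  split.
  - move=> phi /= /eqP phie; split; last by rewrite sumS.
      move=> _ /memS[j [jphi ->]]; split; first by rewrite -memX; apply: valP.
      by apply/(pos_expoE K_real)/eqP.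
    by move=> _ _ /memS[i [_ ->]] /memS[j [_ ->]] /= /val_inj ->.
  - move=> phi psi _ _ eqS; apply/ffunP => j.
    have sub (phi' psi' : {ffun T -> D}) : S phi' = S psi' -> val (phi' j) != 0 ->
        phi' j = psi' j.
      move=> eqS' phi0; have : (val j, val (phi' j)) \in S psi'.
        by rewrite -eqS'; apply/memS; exists j.
      by move=> /memS[i [_ [/val_inj <- /val_inj ->]]].
    have [phi0|phi0] := eqVneq (val (phi j)) 0; last exact: sub.
    have [psi0|psi0] := eqVneq (val (psi j)) 0; last exact/esym/sub.
    by apply: val_inj; rewrite phi0 psi0.
  - move=> U [UQ Uinj Usum].
    (* The inverse encoding: an index that does not occur in [U] receives the default exponent
       [0]. *)
    pose phi : {ffun T -> D} := [ffun j : T =>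
      odflt [` downset0 D]%fset [pick a : D | (val j, val a) \in U]].
    have phiU (j : T) (a : D) : (val j, val a) \in U -> phi j = a.
      move=> jaU; rewrite ffunE; case: pickP => [a' /= ja'U|/(_ a)]; last by rewrite jaU.
      by have [] := Uinj _ _ jaU ja'U erefl; move/val_inj.
    have SU : S phi = U.
      apply/fsetP => -[j a]; apply/memS/idP => [[i [+ [-> ->]]]|jaU].
        rewrite ffunE; case: pickP => [b /= //|_] /=; by rewrite eqxx.
      have [js /(pos_expoE K_real) apos] := UQ _ jaU.
      have jX : j \in X by rewrite memX.
      have aD := memD U _ jaU Usum.
      exists [` jX]%fset; rewrite (@phiU _ [` aD]%fset) //=.
      by split=> //; apply/eqP.
    by exists phi => //=; rewrite -sumS SU Usum.
rewrite -(eq_bigr _ (fun phi _ => prodS phi)) [RHS]bigfs ?index_enum_uniq //.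
by move=> phi _; rewrite mem_index_enum.
Qed.

End TruncationAt.

(** Every exponent lies in some downset, so identities of series may be checked in the truncated
    rings. *)
Lemma trunc_inj f g : (forall D, trunc D f = trunc D g) -> f = g.
Proof.
move=> fg; apply/funext => d; have [D dD] := expo_downset K_real d.
by have /ffunP/(_ [` dD]%fset) := fg D; rewrite !ffunE.
Qed.

Lemma qmul_inj f g h : qmul f g = qone -> qmul f h = qone -> g = h.
Proof.
move=> fg fh; apply: trunc_inj => D.
have {fg}fg : trunc D f * trunc D g = 1 by rewrite -trunc_mul fg trunc1.
have {fh}fh : trunc D f * trunc D h = 1 by rewrite -trunc_mul fh trunc1.
by rewrite -[RHS]mulr1 -fg mulrCA mulrA fh mul1r.
Qed.

Lemma qinvE f g : qmul f g = qone -> qinv f = g.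
Proof.
move=> fg; apply: xget_subset1 => //.
by move=> x y /= fx fy; apply: qmul_inj fx fy.
Qed.

Lemma qgeom_mul (a b : H) : a != 0 -> b != 0 ->
  qdiv qone (qmul (qone - qX a) (qone - qX b)) = qmul (qgeom a) (qgeom b).
Proof.
move=> a0 b0; rewrite /qdiv (@qinvE _ (qmul (qgeom a) (qgeom b))).
  by apply: trunc_inj => D; rewrite trunc_mul trunc1 mul1r.
apply: trunc_inj => D; rewrite !trunc_mul !truncB trunc1 !truncX !trunc_geom //.
by rewrite mulrACA !geomP ?monoX_eq0 // mulr1.
Qed.

Lemma trunc_qdiv_qpoch (D : downset H) c m n : c != 0 ->
  trunc D (qdiv (qX (c *+ m)) (qpoch c n)) =
  mono D c 1 ^+ m * ipoch #|` D| (mono D c 1) n.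
Proof.
move=> c0; rewrite /qdiv.
(* The candidate inverse of [qpoch c n]. That it is an inverse is a statement on full series, so it
   is checked for every [D']. *)
pose g : qsum R K := \big[@qmul R K/qone]_(1 <= j < n.+1) qgeom (c *+ j).
have trunc_g D' : trunc D' g = ipoch #|` D'| (mono D' c 1) n.
  rewrite trunc_prod big_add1 big_mkord; apply: eq_bigr => i _.
  by rewrite trunc_geom_mulrn.
rewrite (@qinvE _ g) ?trunc_mul ?trunc_g ?truncX ?monoX //.
apply: trunc_inj => D'; rewrite trunc_mul trunc_g trunc_prod trunc1.
rewrite -[RHS](pochK n (monoX_eq0 D' c0)); congr (_ * _).
rewrite big_add1 big_mkord; apply: eq_bigr => i _.
by rewrite truncB trunc1 truncX monoX.
Qed.

Lemma qprod_ext (J : choiceType) (A : set J) (F G : J -> qsum R K) :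
  (forall j, A j -> F j = G j) -> qprod A F = qprod A G.
Proof.
move=> FG; apply/funext => d; apply: eq_fsbigr => U /set_mem[UA _ _].
by apply: eq_big_seq => p /UA[/FG ->].
Qed.

(** * The residue classes [a] and [5 - a] modulo 5 *)

Section Residues.
Variable a : nat.
Hypothesis a0 : (0 < a)%N.
Hypothesis a5 : (a < 5)%N.

Definition qfactor c (n : nat) : qsum R K :=
  qdiv qone (qmul (qone - qX (c *+ (5 * n + a))) (qone - qX (c *+ (5 * n + (5 - a))))).

Lemma trunc_qfactor (D : downset H) c n : c != 0 ->
  let q := mono D c 1 in
  trunc D (qfactor c n) =
  geom #|` D| (q ^+ (5 * n + a)) * geom #|` D| (q ^+ (5 * n + (5 - a))).
Proof.
move=> c0 q.
have neq0 m : (0 < m)%N -> c *+ m != 0.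
  by move=> m0; apply/eqP; rewrite -[0](mulr0n c) => /(expo_mulrn_inj c0) m0'; rewrite m0' in m0.
by rewrite /qfactor qgeom_mul ?neq0 ?trunc_mul ?trunc_geom_mulrn //; lia.
Qed.

Lemma card_downset_gt0 (D : downset H) : (0 < #|` D|)%N.
Proof. by rewrite cardfs_gt0; apply/fset0Pn; exists 0; apply: downset0. Qed.

Lemma expo_add_eq0 c d : c + d = 0 -> c = 0.
Proof.
move=> cd; have [tau] := embedding_exists K_real.
have /eqP : tau (expo_val c) + tau (expo_val d) = 0.
  by rewrite -rmorphD -expo_valD cd rmorph0.
rewrite paddr_eq0 ?expo_val_ge0 // => /andP[]; rewrite fmorph_eq0 => /eqP c0 _.
exact: expo_val_inj.
Qed.

(** This downset is [{0}]; truncating to it reads off constant coefficients. *)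
Lemma expo_downset0 : exists D : downset H, #|` D| = 1%N.
Proof.
have D0 : 0 \in [fset (0 : H)]%fset by rewrite inE.
have DD (c d : H) : c + d \in [fset (0 : H)]%fset -> c \in [fset (0 : H)]%fset.
  by rewrite !inE => /eqP/expo_add_eq0 ->.
by exists (Downset D0 DD); rewrite /= cardfs1.
Qed.

Lemma qfactor_at0 c n : c != 0 -> qfactor c n 0 = 1.
Proof.
move=> c0; have [D D1] := expo_downset0; apply: (@trunc_eq1 D).
rewrite trunc_qfactor // !(exp_nilp (monoX_eq0 D c0)) ?geom0 ?mulr1 ?card_downset_gt0 //; lia.
Qed.

(** [M] is left free: regrouping by scale takes the cardinal of [D], the Rogers-Ramanujan identities
    take twice that. *)
Lemma trunc_inner (D : downset H) c M : c != 0 -> (#|` D| <= M)%N ->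
  let q := mono D c 1 in
  trunc D (qprod [set: nat] (qfactor c)) = \prod_(n < M)
    (geom #|` D| (q ^+ (5 * n + a)) * geom #|` D| (q ^+ (5 * n + (5 - a)))).
Proof.
move=> c0 NM q; have qN : q ^+ #|` D| = 0 by apply: monoX_eq0.
have out n : (#|` D| <= n)%N -> trunc D (qfactor c n) = 1.
  move=> Nn; rewrite trunc_qfactor //.
  by rewrite !(exp_nilp qN) ?geom0 ?mulr1 ?card_downset_gt0 //; lia.
rewrite (@trunc_qprod D _ _ _ (iota 0 M)) ?iota_uniq //.
- rewrite -[M in iota 0 M]subn0 big_mkord; apply: eq_bigr => n _.
  exact: trunc_qfactor.
- by move=> n _; apply: qfactor_at0.
- by move=> n _; rewrite mem_iota add0n /= -leqNgt => Mn; apply: out; lia.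
Qed.

Lemma inner_at0 c : c != 0 -> qprod [set: nat] (qfactor c) 0 = 1.
Proof.
move=> c0; have [D D1] := expo_downset0; apply: (@trunc_eq1 D).
rewrite (@trunc_inner D c #|` D|) // big1 // => n _.
by rewrite !(exp_nilp (monoX_eq0 D c0)) ?geom0 ?mulr1 ?card_downset_gt0 //; lia.
Qed.

Lemma qgeom_at0 c : c != 0 -> qgeom c 0 = 1.
Proof.
move=> c0; have [D D1] := expo_downset0; apply: (@trunc_eq1 D).
rewrite trunc_geom // -[mono D c 1]expr1.
by rewrite (exp_nilp (monoX_eq0 D c0)) ?D1 ?geom0.
Qed.

Definition residue (s : nat) := ((s %% 5 == a) || (s %% 5 == 5 - a))%N.

Lemma residue_gt0 s : residue s -> (0 < s)%N.
Proof. by case: s => // /orP[] /eqP /=; lia. Qed.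

Lemma prod_residue (A : comNzRingType) (G : nat -> A) M :
  \prod_(n < M) (G (5 * n + a)%N * G (5 * n + (5 - a))%N) =
  \prod_(s <- iota 0 (5 * M) | residue s) G s.
Proof.
rewrite (_ : iota 0 (5 * M) = index_iota 0 (5 * M)); last by rewrite /index_iota subn0.
elim: M => [|M IH]; first by rewrite big_ord0 big_geq.
rewrite big_ord_recr /= IH [RHS](@big_cat_nat _ _ _ (5 * M)) //=; last lia.
congr (_ * _); rewrite -[X in index_iota X]addn0 [(5 * M + 0)%N]addnC big_addn.
rewrite (_ : 5 * M.+1 - 5 * M = 5)%N; last lia.
rewrite (eq_bigl residue) => [|i]; last by rewrite /residue addnC mulnC modnMDl.
rewrite /index_iota /= !big_cons big_nil /residue.
case: a a0 a5 => [|[|[|[|[|//]]]]] //= _ _; rewrite ?mulr1 ![(5 * M + _)%N]addnC //.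
- by rewrite mulrC.
- by rewrite mulrC.
Qed.

Definition residue_set : set H := [set d | pos_expo d /\
  (scale d = a %[mod 5] \/ scale d = (5 - a) %[mod 5])].

Lemma residueP s : residue s <-> (s = a %[mod 5] \/ s = (5 - a) %[mod 5]).
Proof.
rewrite /residue (modn_small a5) (@modn_small (5 - a)); last lia.
by split=> [/orP[/eqP|/eqP]|[/eqP|/eqP]] ->; rewrite ?orbT; auto.
Qed.

Lemma primitive_neq0 c : primitive c -> c != 0.
Proof. by case=> /(pos_expoE K_real)/eqP. Qed.

(** In each truncated ring both sides are finite products of geometric series, matched by the
    bijection from pairs [(c, s)] to [c *+ s]. Pairs with [c *+ s] outside [D] contribute [1]. *)
Lemma qprod_primitive_residue :
  qprod primitive (fun c => qprod [set: nat] (qfactor c)) =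
  qprod residue_set (fun d => qgeom d).
Proof.
apply: trunc_inj => D; set N := #|` D|.
have mono_D d : d \notin (D : {fset H}) -> mono D d (1 : R) = 0 by apply: mono_out.
rewrite (@trunc_qprod D _ _ _ [seq c <- (D : {fset H}) | `[< primitive c >]]); first last.
- move=> c pc; rewrite mem_filter asboolT //= => cD.
  rewrite (@trunc_inner D c N) ?primitive_neq0 // big1 // => n _.
  (* Here [q = 0], which is nilpotent already with exponent [1]. *)
  rewrite mono_D // !(exp_nilp (expr1 0)); [|lia|lia].
  by rewrite !geom0 ?mulr1 // card_downset_gt0.
- by move=> c /primitive_neq0; apply: inner_at0.
- by move=> c; rewrite mem_filter => /andP[/asboolP].
- by rewrite filter_uniq // fset_uniq.
rewrite (@trunc_qprod D _ _ _ [seq d <- (D : {fset H}) | `[< residue_set d >]]); first last.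
- move=> d dR; rewrite mem_filter (asboolT dR) /= => dD.
  have [/(pos_expoE K_real)/eqP d0 _] := dR.
  by rewrite trunc_geom // mono_D // geom0 // card_downset_gt0.
- by move=> d [/(pos_expoE K_real)/eqP d0 _]; apply: qgeom_at0.
- by move=> c; rewrite mem_filter => /andP[/asboolP].
- by rewrite filter_uniq // fset_uniq.
pose G d := geom N (mono D d (1 : R)).
(* The range [5 * N] comes from [N] blocks of five residues; it is long enough, as [c *+ s] in [D]
   forces [s < N]. *)
pose T := [seq c *+ s | c <- [seq c <- (D : {fset H}) | `[< primitive c >]],
                        s <- [seq s <- iota 0 (5 * N) | residue s]].
transitivity (\prod_(d <- T) G d).
  rewrite big_allpairs_dep !big_filter big_seq_cond [RHS]big_seq_cond.
  apply: eq_bigr => c /andP[_ /asboolP/primitive_neq0 c0].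
  rewrite (@trunc_inner D c N) // big_filter (prod_residue (fun s => geom N (mono D c 1 ^+ s))).
  by apply: eq_bigr => s _; rewrite monoX.
transitivity (\prod_(d <- [seq d <- T | d \in (D : {fset H})]) G d).
  rewrite big_filter [LHS](bigID (mem (D : {fset H}))) /= [X in _ * X]big1 ?mulr1 // => d dD.
  by rewrite /G mono_D // geom0 // card_downset_gt0.
rewrite [RHS](eq_big_seq G) => [|d]; last first.
  by rewrite mem_filter => /andP[/asboolP[/(pos_expoE K_real)/eqP d0 _] _]; rewrite trunc_geom.
apply: perm_big; apply: uniq_perm.
- apply: filter_uniq; apply: allpairs_uniq.
  + by rewrite filter_uniq // fset_uniq.
  + by rewrite filter_uniq // iota_uniq.
  move=> _ _ /allpairsP[[c s] [/= + + ->]] /allpairsP[[c' s'] [/= + + ->]] /=.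
  rewrite !mem_filter => /andP[/asboolP pc _] /andP[rs _] /andP[/asboolP pc' _] /andP[rs' _].
  by move=> /(primitive_mulrn_inj pc pc' (residue_gt0 rs) (residue_gt0 rs'))[-> ->].
- by rewrite filter_uniq // fset_uniq.
move=> d; rewrite !mem_filter; apply/andP/andP => [[dD]|[/asboolP[dpos sd] dD]].
  move=> /allpairsP[[c s] [/=]]; rewrite !mem_filter => /andP[/asboolP pc _] /andP[rs _] dE.
  split=> //; apply/asboolP; rewrite dE.
  split; last by rewrite scaleE ?residue_gt0 //; apply/residueP.
  apply/(pos_expoE K_real); rewrite -[0](mulr0n c).
  by move=> /(expo_mulrn_inj (primitive_neq0 pc)) s0; rewrite s0 in rs; have := residue_gt0 rs.
have /eqP d0 := (pos_expoE K_real d).1 dpos.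
have [t [s [pt s0 dE]]] := exists_primitive_factor K_real d0.
split=> //; apply/allpairsP; exists (t, s); rewrite /= !mem_filter mem_iota add0n asboolT //=.
rewrite dE in dD; split=> //.
  by apply: (@downsetD _ D _ (t *+ s.-1)); rewrite -mulrS prednK.
apply/andP; split; first by apply/residueP; rewrite -(scaleE pt s0) -dE.
have [//|Ns] := ltnP s (5 * N).
have Ns' : (N <= s)%N := leq_trans (leq_pmull N (isT : 0 < 5)%N) Ns.
by have := mulrn_notin_downset (primitive_neq0 pt) Ns'; rewrite dD.
Qed.

Lemma trunc_rr_series (D : downset H) c (e : nat -> nat) : c != 0 ->
  (forall n, (n <= e n)%N) ->
  trunc D (qseries (fun n => qdiv (qX (c *+ e n)) (qpoch c n))) =
  \sum_(n < #|` D|) mono D c 1 ^+ e n * ipoch #|` D| (mono D c 1) n.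
Proof.
move=> c0 en; rewrite (@trunc_series D _ #|` D|) => [|n Dn].
  by apply: eq_bigr => n _; rewrite trunc_qdiv_qpoch.
by rewrite trunc_qdiv_qpoch // (exp_nilp (monoX_eq0 D c0)) ?mul0r // (leq_trans Dn).
Qed.

(** In each truncated ring both sides are inverses of the same finite product of factors
    [1 - q^i]. *)
Lemma rr_series_inner c (e : nat -> nat) : c != 0 -> (forall n, (n <= e n)%N) ->
  (forall (A : comNzRingType) N (q : A) m, q ^+ N = 0 -> (2 * N <= m)%N ->
    (\sum_(n < N) q ^+ e n * ipoch N q n) *
    \prod_(i < m) ((1 - q ^+ (5 * i + a)) * (1 - q ^+ (5 * i + (5 - a)))) = 1) ->
  qseries (fun n => qdiv (qX (c *+ e n)) (qpoch c n)) =
  qprod [set: nat] (qfactor c).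
Proof.
move=> c0 en rr; apply: trunc_inj => D; set N := #|` D|.
have qN := monoX_eq0 D c0.
rewrite trunc_rr_series // (@trunc_inner D c (2 * N)) //; last by rewrite leq_pmull.
have := rr _ N _ (2 * N)%N qN (leqnn _); move: (mono D c 1) qN => q qN h.
have qXN m : (0 < m)%N -> (q ^+ m) ^+ N = 0.
  by move=> m0; rewrite -exprM mulnC exprM qN expr0n gtn_eqF.
have PQ : \prod_(i < 2 * N) ((1 - q ^+ (5 * i + a)) * (1 - q ^+ (5 * i + (5 - a)))) *
    \prod_(i < 2 * N) (geom N (q ^+ (5 * i + a)) * geom N (q ^+ (5 * i + (5 - a)))) = 1.
  by rewrite -big_split big1 // => n _ /=; rewrite mulrACA !geomP ?mulr1 // qXN //; lia.
by rewrite -[LHS]mulr1 -[X in _ * X]PQ mulrA h mul1r.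
Qed.

End Residues.

End Truncation.

Theorem corollary3p11 (R : realType) (K : fieldExtType rat)
    (K_real : totally_real R K) :
   (qprod primitive (fun c : expo R K =>
         qseries (fun n : nat => qdiv (qX (c *+ (n ^ 2))) (qpoch c n)))
     = qprod primitive (fun c : expo R K =>
         qprod [set: nat] (fun n : nat =>
           qdiv qone (qmul (qone - qX (c *+ (5 * n + 1)))
                           (qone - qX (c *+ (5 * n + 4))))))
    /\
    qprod primitive (fun c : expo R K =>
         qprod [set: nat] (fun n : nat =>
           qdiv qone (qmul (qone - qX (c *+ (5 * n + 1)))
                           (qone - qX (c *+ (5 * n + 4))))))
     = qprod [set d : expo R K | pos_expo d /\
                (scale d = 1 %[mod 5] \/ scale d = 4 %[mod 5])]
         (fun d : expo R K => qgeom d))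
  /\
   (qprod primitive (fun c : expo R K =>
         qseries (fun n : nat => qdiv (qX (c *+ (n * (n + 1)))) (qpoch c n)))
     = qprod primitive (fun c : expo R K =>
         qprod [set: nat] (fun n : nat =>
           qdiv qone (qmul (qone - qX (c *+ (5 * n + 2)))
                           (qone - qX (c *+ (5 * n + 3))))))
    /\
    qprod primitive (fun c : expo R K =>
         qprod [set: nat] (fun n : nat =>
           qdiv qone (qmul (qone - qX (c *+ (5 * n + 2)))
                           (qone - qX (c *+ (5 * n + 3))))))
     = qprod [set d : expo R K | pos_expo d /\
                (scale d = 2 %[mod 5] \/ scale d = 3 %[mod 5])]
         (fun d : expo R K => qgeom d)).
Proof.
split; split.
- apply: qprod_ext => c /(primitive_neq0 K_real) c0.
  apply: (rr_series_inner K_real (a := 1)) => // [n|A N q m qN Nm]; first by nia.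
  rewrite -[RHS](rogers_ramanujan1 qN Nm); congr (_ * _).
  by apply: eq_bigr => n _; rewrite mul0n addn0.
(* For [a = 1] the number [5 - a] computes to [4], so the two statements agree by conversion. *)
- exact: (qprod_primitive_residue K_real (a := 1)).
- apply: qprod_ext => c /(primitive_neq0 K_real) c0.
  apply: (rr_series_inner K_real (a := 2)) => // [n|A N q m qN Nm]; first by nia.
  rewrite -[RHS](rogers_ramanujan2 qN Nm); congr (_ * _).
  by apply: eq_bigr => n _; rewrite mul1n mulnDr muln1.
- exact: (qprod_primitive_residue K_real (a := 2)).
Qed.
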